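(* Suppose given types $A,B:\mathcal U$ (in an arbitrary ambient context) and a type family $$P : \sqrt{}_{L}\Big(\big(\prod_{t:\mathbb T} (A\langle t/L\rangle + B\langle t/L\rangle)\big)\to\mathcal U\Big).$$ Then there is a map $$\mathsf{hind} : \sqrt{}_{L}\Big(\prod_{l:\prod_{t:\mathbb T}A\langle t/L\rangle} P_{\downarrow}(\mathsf{inl}\circ l)\Big)\times \sqrt{}_{L}\Big(\prod_{r:\prod_{t:\mathbb T}B\langle t/L\rangle} P_{\downarrow}(\mathsf{inr}\circ r)\Big)\to \sqrt{}_{L}\Big(\prod_{f:\prod_{t:\mathbb T}(A\langle t/L\rangle+B\langle t/L\rangle)} P_{\downarrow}(f)\Big)$$ such that for all $g,h$ in the two factors of the domain, and for any $l:\sqrt{}_{L}(\prod_{t:\mathbb T}A\langle t/L\rangle)$ and $r:\sqrt{}_{L}(\prod_{t:\mathbb T}B\langle t/L\rangle)$, the following definitional equalities hold in the context extended on the right by $\mathsf{lock}_L$ (so that $g,h,l,r$ all lie behind $\mathsf{lock}_L$): $$\mathsf{hind}(g,h)_{\downarrow}\big(\lambda t.\,\mathsf{inl}(l_{\downarrow}(t))\big)\equiv g_{\downarrow}(l_{\downarrow}),\qquad \mathsf{hind}(g,h)_{\downarrow}\big(\lambda t.\,\mathsf{inr}(r_{\downarrow}(t))\big)\equiv h_{\downarrow}(r_{\downarrow}).$$ Here, behind $\mathsf{lock}_L$, $x_\downarrow$ means $\mathsf{ev}(i.\,x\langle i/L\rangle)$ for a variable $x$, and $\mathsf{hind}(g,h)_{\downarrow}$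 means $\mathsf{ev}(i.\,\mathsf{hind}(g,h)[i/\mathsf{key}_L])$.
   Context: Ambient type theory: intensional Martin-Löf type theory with dependent products and sums (with definitional $\beta$ and $\eta$), binary coproduct types $+$ with constructors $\mathsf{inl},\mathsf{inr}$ and dependent case analysis with definitional $\beta$, identity types, and a hierarchy of universes written $\mathcal U$ (levels implicit). $\equiv$ is definitional equality. A vector such as $\vec t/L$ abbreviates a sequence $t_1/L_1,\dots,t_n/L_n$. The theory is extended as follows. (1) There is a closed type $\mathbb T$. (2) If $\Gamma$ is a context, so is $\Gamma,\mathsf{lock}_L$, where $L$ is a fresh lock name. (Binders extend the context on the right.) (3) Variables: if $L_1,\dots,L_n$ are the locks occurring (in order) in $\Gamma'$, and $\Gamma,x:A,\Gamma'\vdash t_m:\mathbb T$ for each $m$, then $\Gamma,x:A,\Gamma'\vdash x\langle \vec t/L\rangle : A[\vec t/\mathsf{key}_L]$. (With no locks this is the usual rule.) (4) Counit (admissible): from $\Gamma,\Gamma''\vdash a:A$ and a term $\Gamma,\Gamma'\vdash t_m:\mathbb T$ for each lock $L_m$ of $\Gamma'$, one gets $\Gamma,\Gamma',\Gamma''[\vec t/\mathsf{key}_L]\vdash a[\vec t/\mathsf{key}_L]:A[\vec t/\mathsf{key}_L]$. It commutes with all type and term formers; on variables, for $x$ in $\Gamma$ with $J$ the locks of $\Gamma$ after $x$ and $K$ the locks of $\Gamma''$, $x\langle \vec j/J,\vec k/K\rangle[\vec t/\mathsf{key}_L]:\equiv x\langle \vec j[\vec t/\mathsf{key}_L]/J,\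 \vec t\,[\vec k[\vec t/\mathsf{key}_L]/\mathsf{key}_K]/L,\ \vec k[\vec t/\mathsf{key}_L]/K\rangle$; for $x$ in $\Gamma''$ (in particular bound), $x\langle\vec k/K\rangle[\vec t/\mathsf{key}_L]:\equiv x\langle\vec k[\vec t/\mathsf{key}_L]/K\rangle$. (5) Substitution: $(y\langle\vec t/L\rangle)[a/x]:\equiv y\langle\vec t[a/x]/L\rangle$ for $y\neq x$, and $(x\langle\vec t/L\rangle)[a/x]:\equiv a[\vec t[a/x]/\mathsf{key}_L]$. (6) Unit (admissible): from $\Gamma,i:\mathbb T,\mathsf{lock}_L,\Gamma'\vdash a:A$ one gets $\Gamma,\Gamma'[i./\mathsf{lock}_L]\vdash a[i./\mathsf{lock}_L]:A[i./\mathsf{lock}_L]$. It commutes with all formers; on variables, $i\langle t/L,\vec k/K\rangle\mapsto t[i./\mathsf{lock}_L]$; for $x$ in $\Gamma$, $x\langle\vec j/J,t/L,\vec k/K\rangle\mapsto x\langle\vec j[i./\mathsf{lock}_L]/J,\vec k[i./\mathsf{lock}_L]/K\rangle$; for $x$ in $\Gamma'$ or bound, $x\langle\vec k/K\rangle\mapsto x\langle\vec k[i./\mathsf{lock}_L]/K\rangle$. (7) Type former $\sqrt{}$ (right adjoint to $\mathsf{lock}$): if $\Gamma,\mathsf{lock}_L\vdash A:\mathcal U$ then $\Gamma\vdash\sqrt{}_L A:\mathcal U$; if $\Gamma,\mathsf{lock}_L\vdash a:A$ then $\Gamma\vdash \mathsf{lock}_L.\,a:\sqrt{}_L A$; if $\Gamma,i:\mathbb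 T\vdash r:\sqrt{}_L A$ then $\Gamma\vdash\mathsf{ev}(i.\,r):A[i./\mathsf{lock}_L]$ ($i$ bound in $r$). Computation: $\mathsf{ev}(i.\,\mathsf{lock}_L.\,a)\equiv a[i./\mathsf{lock}_L]$; $\eta$: $r\equiv\mathsf{lock}_L.\,\mathsf{ev}(i.\,r[i/\mathsf{key}_L])$. *)

(* Defs.v *)
From Stdlib Require Import List Arith Lia.
Import ListNotations.

(** * Raw syntax

    Binding is nameless.  [Abs a] is [x. a], binding the variable 0, and [LAbs a]
    is [lock_L. a], binding a lock; they only occur as arguments of formers.
    [Var x ts] is [x<ts/L>]: variables are counted from the right end of the
    context, ignoring locks, and [ts] lists the keys for the locks
    [L_1, ..., L_n] to the right of [x], in context order. *)

Inductive op : Set :=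
  | OUniv (n : nat) | OTiny
  | OPi | OLam | OApp
  | OSig | OPair | OFst | OSnd
  | OSum | OInl | OInr | OCase
  | OId | ORefl | OJ
  | OSqrt | OLock | OEv.

Inductive tm : Set :=
  | Var (x : nat) (ts : list tm)
  | Op (o : op) (us : list tm)
  | Abs (a : tm)
  | LAbs (a : tm).

Notation Univ n := (Op (OUniv n) []).
Notation Tiny := (Op OTiny []).
Notation Pi A B := (Op OPi [A; Abs B]).
Notation Lam b := (Op OLam [Abs b]).
Notation App f a := (Op OApp [f; a]).
Notation Sig A B := (Op OSig [A; Abs B]).
Notation Pair a b := (Op OPair [a; b]).
Notation Fst p := (Op OFst [p]).
Notation Snd p := (Op OSnd [p]).
Notation Sum A B := (Op OSum [A; B]).
Notation Inl a := (Op OInl [a]).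
Notation Inr b := (Op OInr [b]).
Notation Case s u v := (Op OCase [s; Abs u; Abs v]).
Notation Id A a b := (Op OId [A; a; b]).
Notation Refl a := (Op ORefl [a]).
Notation J d q := (Op OJ [d; q]).
Notation Sqrt A := (Op OSqrt [LAbs A]).
Notation Lock a := (Op OLock [LAbs a]).
Notation Ev r := (Op OEv [Abs r]).

(** * Counit, substitution and unit

    [counit n ts p q a a'] is the graph of [a[ts/key_L] = a'], for [a] over
    [Γ,Γ''] and [a'] over [Γ,Γ',Γ''[ts/key_L]], where [Γ'] has [n] variables and
    [length ts] locks, and [Γ''] has [p] variables and [q] locks.  With [ts = []]
    it is weakening.  It is given as a graph because its recursion is not
    structural: the keys [ts] are themselves traversed, as [ts[ks'/key_K]]. *)

Inductive counit : nat -> list tm -> nat -> nat -> tm -> tm -> Prop :=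
  | counit_inner n ts p q x ks ks' :
      x < p ->
      Forall2 (counit n ts p q) ks ks' ->
      counit n ts p q (Var x ks) (Var x ks')
  | counit_outer n ts p q x js js' ks ks' us :
      p <= x ->
      length ks = q ->
      Forall2 (counit n ts p q) js js' ->
      Forall2 (counit n ts p q) ks ks' ->
      Forall2 (counit p ks' 0 0) ts us ->
      counit n ts p q (Var x (js ++ ks)) (Var (n + x) (js' ++ us ++ ks'))
  | counit_op n ts p q o us us' :
      Forall2 (counit n ts p q) us us' ->
      counit n ts p q (Op o us) (Op o us')
  | counit_abs n ts p q a a' :
      counit n ts (S p) q a a' ->
      counit n ts p q (Abs a) (Abs a')
  | counit_labs n ts p q a a' :
      counit n ts p (S q) a a' ->
      counit n ts p q (LAbs a) (LAbs a').

Lemma counit_functional n ts p q a a1 a2 :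
  counit n ts p q a a1 -> counit n ts p q a a2 -> a1 = a2.
Proof.
  assert (lists : forall (S : tm -> tm -> Prop) l l1 l2,
    Forall2 (fun x y => forall z, S x z -> y = z) l l1 ->
    Forall2 S l l2 -> l1 = l2).
  { intros S l l1 l2 H; revert l2.
    induction H; intros l2 H2; inversion H2; subst; f_equal; auto. }
  assert (split : forall l1 l2 m1 m2 : list tm,
    l1 ++ l2 = m1 ++ m2 -> length l2 = length m2 -> l1 = m1 /\ l2 = m2).
  { intros l1 l2 m1 m2 E L.
    destruct (app_eq_app _ _ _ _ E) as [[|t l] [[-> ->]|[-> ->]]];
      rewrite ?app_nil_r; auto; simpl in L; rewrite length_app in L; lia. }
  intros H; revert a2; revert n ts p q a a1 H.
  fix IH 7; intros n ts p q a a1 H.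
  assert (IHs : forall n ts p q l l', Forall2 (counit n ts p q) l l' ->
    Forall2 (fun x y => forall z, counit n ts p q x z -> y = z) l l').
  { clear - IH.
    exact (fun n ts p q => fix go l l' HF := match HF with
      | Forall2_nil _ => Forall2_nil _
      | Forall2_cons x y h t => Forall2_cons x y (IH n ts p q x y h) (go _ _ t)
      end). }
  destruct H as [n ts p q x ks ks' ? Hk
                |n ts p q x js js' ks ks' us ? ? Hj Hk Hu
                |n ts p q o us us' Hu|n ts p q a a' Ha|n ts p q a a' Ha];
    intros a2 H2.
  - apply IHs in Hk; inversion H2; subst; [f_equal; eapply lists; eassumption|lia].
  - apply IHs in Hj, Hk, Hu.
    inversion H2 as [|? ? ? ? ? js2 js2' ks2 ks2' us2 ? ? Hj2 Hk2 Hu2| | |]; subst.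
    + lia.
    + match goal with E : _ ++ _ = _ ++ _ |- _ =>
        apply split in E as [-> ->]; [|congruence] end.
      assert (ks2' = ks') as -> by (symmetry; eapply lists; eassumption).
      repeat f_equal; eapply lists; eassumption.
  - apply IHs in Hu; inversion H2; subst; f_equal; eapply lists; eassumption.
  - inversion H2; subst; f_equal; apply (IH _ _ _ _ _ _ Ha); assumption.
  - inversion H2; subst; f_equal; apply (IH _ _ _ _ _ _ Ha); assumption.
Qed.

(** [subst a p b b'] is the graph of [b[a/x] = b'], for [b] over [Γ,x:A,Γ''] with
    [Γ''] having [p] variables, and [a] over [Γ]. *)
Inductive subst : tm -> nat -> tm -> tm -> Prop :=
  | subst_inner a p y ts ts' :
      y < p ->
      Forall2 (subst a p) ts ts' ->
      subst a p (Var y ts) (Var y ts')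
  | subst_this a p ts ts' a' :
      Forall2 (subst a p) ts ts' ->
      counit p ts' 0 0 a a' ->
      subst a p (Var p ts) a'
  | subst_outer a p y ts ts' :
      p < y ->
      Forall2 (subst a p) ts ts' ->
      subst a p (Var y ts) (Var (pred y) ts')
  | subst_op a p o us us' :
      Forall2 (subst a p) us us' ->
      subst a p (Op o us) (Op o us')
  | subst_abs a p b b' :
      subst a (S p) b b' ->
      subst a p (Abs b) (Abs b')
  | subst_labs a p b b' :
      subst a p b b' ->
      subst a p (LAbs b) (LAbs b').

(** [unit_lock p q a] is [a[i./lock_L]], for [a] over [Γ,i:T,lock_L,Γ'] with [Γ']
    having [p] variables and [q] locks.  The default value of [hd] is only
    reached on ill-scoped terms, where [i] comes without a key for [lock_L]. *)
Fixpoint unit_lock (p q : nat) (a : tm) : tm :=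
  match a with
  | Var y ts =>
      let us := map (unit_lock p q) ts in
      match Nat.compare y p with
      | Lt => Var y us
      | Eq => hd (Var y us) us
      | Gt =>
          Var (pred y)
            (firstn (length us - S q) us ++ skipn (length us - q) us)
      end
  | Op o us => Op o (map (unit_lock p q) us)
  | Abs b => Abs (unit_lock (S p) q b)
  | LAbs b => LAbs (unit_lock p (S q) b)
  end.

Definition weak (n : nat) (a a' : tm) : Prop := counit n [] 0 0 a a'.

(** [keyed n a a'] is [a[i/key_L] = a'] for the passage from [Γ] to [Γ,Γ',i:T],
    where [Γ',i:T] contains the lock [L] (with [i] to its right) and [n] variables
    including [i]. *)
Definition keyed (n : nat) (a a' : tm) : Prop := counit n [Var 0 []] 0 0 a a'.

(** [down n a d] is [a_↓ = d], where [d = ev(i. a[i/key_L])] lives over [Γ,Γ'],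
    with [Γ'] consisting of the lock [L] and [n] variables. *)
Definition down (n : nat) (a d : tm) : Prop :=
  exists r, keyed (S n) a r /\ d = Ev r.

(** [x_↓] for a variable [x] separated from the end of the context by one lock. *)
Notation vdown x := (Ev (Var (S x) [Var 0 []])).

(** * Judgements

    Contexts are lists with the most recent entry at the head. *)

Inductive entry : Set :=
  | EVar (A : tm)
  | ELock.

Definition ctx := list entry.

Definition nvars (Γ : ctx) : nat :=
  length (filter (fun e => match e with EVar _ => true | ELock => false end) Γ).

Definition nlocks (Γ : ctx) : nat :=
  length (filter (fun e => match e with EVar _ => false | ELock => true end) Γ).

Reserved Notation "Γ ⊢ a ∷ A" (at level 70, a at level 69, A at level 69).
Reserved Notation "Γ ⊢ a ≡ b ∷ A"
  (at level 70, a at level 69, b at level 69, A at level 69).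

(** Universes are à la Russell, indexed by [nat]. *)

Inductive wf : ctx -> Prop :=
  | wf_nil : wf []
  | wf_var Γ A i :
      wf Γ -> Γ ⊢ A ∷ Univ i ->
      wf (EVar A :: Γ)
  | wf_lock Γ :
      wf Γ ->
      wf (ELock :: Γ)

with typing : ctx -> tm -> tm -> Prop :=
  | ty_conv Γ a A B i :
      Γ ⊢ a ∷ A -> Γ ⊢ A ≡ B ∷ Univ i ->
      Γ ⊢ a ∷ B
  | ty_var Γ Γ' A A' ts :
      wf (Γ' ++ EVar A :: Γ) ->
      length ts = nlocks Γ' ->
      (forall t, In t ts -> Γ' ++ EVar A :: Γ ⊢ t ∷ Tiny) ->
      counit (S (nvars Γ')) ts 0 0 A A' ->
      Γ' ++ EVar A :: Γ ⊢ Var (nvars Γ') ts ∷ A'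

  | ty_univ Γ i :
      wf Γ ->
      Γ ⊢ Univ i ∷ Univ (S i)
  | ty_tiny Γ :
      wf Γ ->
      Γ ⊢ Tiny ∷ Univ 0

  | ty_pi Γ A B i j :
      Γ ⊢ A ∷ Univ i -> EVar A :: Γ ⊢ B ∷ Univ j ->
      Γ ⊢ Pi A B ∷ Univ (Nat.max i j)
  | ty_lam Γ A B b i :
      Γ ⊢ A ∷ Univ i -> EVar A :: Γ ⊢ b ∷ B ->
      Γ ⊢ Lam b ∷ Pi A B
  | ty_app Γ A B B' f a :
      Γ ⊢ f ∷ Pi A B -> Γ ⊢ a ∷ A -> subst a 0 B B' ->
      Γ ⊢ App f a ∷ B'

  | ty_sig Γ A B i j :
      Γ ⊢ A ∷ Univ i -> EVar A :: Γ ⊢ B ∷ Univ j ->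
      Γ ⊢ Sig A B ∷ Univ (Nat.max i j)
  | ty_pair Γ A B B' a b j :
      EVar A :: Γ ⊢ B ∷ Univ j ->
      Γ ⊢ a ∷ A -> subst a 0 B B' -> Γ ⊢ b ∷ B' ->
      Γ ⊢ Pair a b ∷ Sig A B
  | ty_fst Γ A B p :
      Γ ⊢ p ∷ Sig A B ->
      Γ ⊢ Fst p ∷ A
  | ty_snd Γ A B B' p :
      Γ ⊢ p ∷ Sig A B -> subst (Fst p) 0 B B' ->
      Γ ⊢ Snd p ∷ B'

  | ty_sum Γ A B i j :
      Γ ⊢ A ∷ Univ i -> Γ ⊢ B ∷ Univ j ->
      Γ ⊢ Sum A B ∷ Univ (Nat.max i j)
  | ty_inl Γ A B a j :
      Γ ⊢ B ∷ Univ j -> Γ ⊢ a ∷ A ->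
      Γ ⊢ Inl a ∷ Sum A B
  | ty_inr Γ A B b i :
      Γ ⊢ A ∷ Univ i -> Γ ⊢ b ∷ B ->
      Γ ⊢ Inr b ∷ Sum A B
  (* [C1] is [C] over [Γ,x,z], so [Cl] and [Cr] are [C[inl x/z]] and [C[inr x/z]]. *)
  | ty_case Γ A B C C1 Cl Cr C' s u v i :
      EVar (Sum A B) :: Γ ⊢ C ∷ Univ i ->
      counit 1 [] 1 0 C C1 ->
      subst (Inl (Var 0 [])) 0 C1 Cl -> EVar A :: Γ ⊢ u ∷ Cl ->
      subst (Inr (Var 0 [])) 0 C1 Cr -> EVar B :: Γ ⊢ v ∷ Cr ->
      Γ ⊢ s ∷ Sum A B -> subst s 0 C C' ->
      Γ ⊢ Case s u v ∷ C'

  | ty_id Γ A a b i :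
      Γ ⊢ A ∷ Univ i -> Γ ⊢ a ∷ A -> Γ ⊢ b ∷ A ->
      Γ ⊢ Id A a b ∷ Univ i
  | ty_refl Γ A a :
      Γ ⊢ a ∷ A ->
      Γ ⊢ Refl a ∷ Id A a a
  | ty_J Γ A A1 a a1 b C C0 D C1 E d q j :
      weak 1 A A1 -> weak 1 a a1 ->
      EVar (Id A1 a1 (Var 0 [])) :: EVar A :: Γ ⊢ C ∷ Univ j ->
      subst a 1 C C0 -> subst (Refl a) 0 C0 D -> Γ ⊢ d ∷ D ->
      Γ ⊢ a ∷ A -> Γ ⊢ b ∷ A -> Γ ⊢ q ∷ Id A a b ->
      subst b 1 C C1 -> subst q 0 C1 E ->
      Γ ⊢ J d q ∷ E

  | ty_sqrt Γ A i :
      ELock :: Γ ⊢ A ∷ Univ i ->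
      Γ ⊢ Sqrt A ∷ Univ i
  | ty_lock Γ A a :
      ELock :: Γ ⊢ a ∷ A ->
      Γ ⊢ Lock a ∷ Sqrt A
  | ty_ev Γ A r :
      EVar Tiny :: Γ ⊢ r ∷ Sqrt A ->
      Γ ⊢ Ev r ∷ unit_lock 0 0 A
where "Γ ⊢ a ∷ A" := (typing Γ a A)

with equal : ctx -> tm -> tm -> tm -> Prop :=
  | deq_reflexive Γ a A :
      Γ ⊢ a ∷ A ->
      Γ ⊢ a ≡ a ∷ A
  | deq_symmetric Γ a b A :
      Γ ⊢ a ≡ b ∷ A ->
      Γ ⊢ b ≡ a ∷ A
  | deq_transitive Γ a b c A :
      Γ ⊢ a ≡ b ∷ A -> Γ ⊢ b ≡ c ∷ A ->
      Γ ⊢ a ≡ c ∷ A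
  | deq_conv Γ a b A B i :
      Γ ⊢ a ≡ b ∷ A -> Γ ⊢ A ≡ B ∷ Univ i ->
      Γ ⊢ a ≡ b ∷ B

  (* Computation and uniqueness *)
  | deq_pi_beta Γ A B B' b b' a i :
      Γ ⊢ A ∷ Univ i -> EVar A :: Γ ⊢ b ∷ B -> Γ ⊢ a ∷ A ->
      subst a 0 b b' -> subst a 0 B B' ->
      Γ ⊢ App (Lam b) a ≡ b' ∷ B'
  | deq_pi_eta Γ A B f f' :
      Γ ⊢ f ∷ Pi A B -> weak 1 f f' ->
      Γ ⊢ f ≡ Lam (App f' (Var 0 [])) ∷ Pi A B

  | deq_fst_beta Γ A B B' a b j :
      EVar A :: Γ ⊢ B ∷ Univ j ->
      Γ ⊢ a ∷ A -> subst a 0 B B' -> Γ ⊢ b ∷ B' ->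
      Γ ⊢ Fst (Pair a b) ≡ a ∷ A
  | deq_snd_beta Γ A B B' a b j :
      EVar A :: Γ ⊢ B ∷ Univ j ->
      Γ ⊢ a ∷ A -> subst a 0 B B' -> Γ ⊢ b ∷ B' ->
      Γ ⊢ Snd (Pair a b) ≡ b ∷ B'
  | deq_sig_eta Γ A B p :
      Γ ⊢ p ∷ Sig A B ->
      Γ ⊢ p ≡ Pair (Fst p) (Snd p) ∷ Sig A B

  | deq_inl_beta Γ A B C C1 Cl Cr C' a u v u' i :
      EVar (Sum A B) :: Γ ⊢ C ∷ Univ i ->
      counit 1 [] 1 0 C C1 ->
      subst (Inl (Var 0 [])) 0 C1 Cl -> EVar A :: Γ ⊢ u ∷ Cl ->
      subst (Inr (Var 0 [])) 0 C1 Cr -> EVar B :: Γ ⊢ v ∷ Cr ->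
      Γ ⊢ a ∷ A -> subst (Inl a) 0 C C' -> subst a 0 u u' ->
      Γ ⊢ Case (Inl a) u v ≡ u' ∷ C'
  | deq_inr_beta Γ A B C C1 Cl Cr C' b u v v' i :
      EVar (Sum A B) :: Γ ⊢ C ∷ Univ i ->
      counit 1 [] 1 0 C C1 ->
      subst (Inl (Var 0 [])) 0 C1 Cl -> EVar A :: Γ ⊢ u ∷ Cl ->
      subst (Inr (Var 0 [])) 0 C1 Cr -> EVar B :: Γ ⊢ v ∷ Cr ->
      Γ ⊢ b ∷ B -> subst (Inr b) 0 C C' -> subst b 0 v v' ->
      Γ ⊢ Case (Inr b) u v ≡ v' ∷ C'

  | deq_J_beta Γ A A1 a a1 C C0 D d j :
      weak 1 A A1 -> weak 1 a a1 ->
      EVar (Id A1 a1 (Var 0 [])) :: EVar A :: Γ ⊢ C ∷ Univ j ->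
      subst a 1 C C0 -> subst (Refl a) 0 C0 D -> Γ ⊢ d ∷ D ->
      Γ ⊢ a ∷ A ->
      Γ ⊢ J d (Refl a) ≡ d ∷ D

  | deq_sqrt_beta Γ A a :
      ELock :: EVar Tiny :: Γ ⊢ a ∷ A ->
      Γ ⊢ Ev (Lock a) ≡ unit_lock 0 0 a ∷ unit_lock 0 0 A
  | deq_sqrt_eta Γ A r r' :
      Γ ⊢ r ∷ Sqrt A -> keyed 1 r r' ->
      Γ ⊢ r ≡ Lock (Ev r') ∷ Sqrt A

  (* Congruence *)
  | deq_var Γ x ts ts' A :
      Γ ⊢ Var x ts ∷ A ->
      length ts = length ts' ->
      (forall m t t', nth_error ts m = Some t -> nth_error ts' m = Some t' ->
         Γ ⊢ t ≡ t' ∷ Tiny) ->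
      Γ ⊢ Var x ts ≡ Var x ts' ∷ A

  | deq_pi Γ A A' B B' i j :
      Γ ⊢ A ∷ Univ i ->
      Γ ⊢ A ≡ A' ∷ Univ i -> EVar A :: Γ ⊢ B ≡ B' ∷ Univ j ->
      Γ ⊢ Pi A B ≡ Pi A' B' ∷ Univ (Nat.max i j)
  | deq_lam Γ A B b b' i :
      Γ ⊢ A ∷ Univ i -> EVar A :: Γ ⊢ b ≡ b' ∷ B ->
      Γ ⊢ Lam b ≡ Lam b' ∷ Pi A B
  | deq_app Γ A B B' f f' a a' :
      Γ ⊢ f ≡ f' ∷ Pi A B -> Γ ⊢ a ≡ a' ∷ A -> subst a 0 B B' ->
      Γ ⊢ App f a ≡ App f' a' ∷ B'

  | deq_sig Γ A A' B B' i j :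
      Γ ⊢ A ∷ Univ i ->
      Γ ⊢ A ≡ A' ∷ Univ i -> EVar A :: Γ ⊢ B ≡ B' ∷ Univ j ->
      Γ ⊢ Sig A B ≡ Sig A' B' ∷ Univ (Nat.max i j)
  | deq_pair Γ A B B' a a' b b' j :
      EVar A :: Γ ⊢ B ∷ Univ j ->
      Γ ⊢ a ≡ a' ∷ A -> subst a 0 B B' -> Γ ⊢ b ≡ b' ∷ B' ->
      Γ ⊢ Pair a b ≡ Pair a' b' ∷ Sig A B
  | deq_fst Γ A B p p' :
      Γ ⊢ p ≡ p' ∷ Sig A B ->
      Γ ⊢ Fst p ≡ Fst p' ∷ A
  | deq_snd Γ A B B' p p' :
      Γ ⊢ p ≡ p' ∷ Sig A B -> subst (Fst p) 0 B B' ->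
      Γ ⊢ Snd p ≡ Snd p' ∷ B'

  | deq_sum Γ A A' B B' i j :
      Γ ⊢ A ≡ A' ∷ Univ i -> Γ ⊢ B ≡ B' ∷ Univ j ->
      Γ ⊢ Sum A B ≡ Sum A' B' ∷ Univ (Nat.max i j)
  | deq_inl Γ A B a a' j :
      Γ ⊢ B ∷ Univ j -> Γ ⊢ a ≡ a' ∷ A ->
      Γ ⊢ Inl a ≡ Inl a' ∷ Sum A B
  | deq_inr Γ A B b b' i :
      Γ ⊢ A ∷ Univ i -> Γ ⊢ b ≡ b' ∷ B ->
      Γ ⊢ Inr b ≡ Inr b' ∷ Sum A B
  | deq_case Γ A B C C1 Cl Cr C' s s' u u' v v' i :
      EVar (Sum A B) :: Γ ⊢ C ∷ Univ i ->
      counit 1 [] 1 0 C C1 ->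
      subst (Inl (Var 0 [])) 0 C1 Cl -> EVar A :: Γ ⊢ u ≡ u' ∷ Cl ->
      subst (Inr (Var 0 [])) 0 C1 Cr -> EVar B :: Γ ⊢ v ≡ v' ∷ Cr ->
      Γ ⊢ s ≡ s' ∷ Sum A B -> subst s 0 C C' ->
      Γ ⊢ Case s u v ≡ Case s' u' v' ∷ C'

  | deq_id Γ A A' a a' b b' i :
      Γ ⊢ A ≡ A' ∷ Univ i -> Γ ⊢ a ≡ a' ∷ A -> Γ ⊢ b ≡ b' ∷ A ->
      Γ ⊢ Id A a b ≡ Id A' a' b' ∷ Univ i
  | deq_refl Γ A a a' :
      Γ ⊢ a ≡ a' ∷ A ->
      Γ ⊢ Refl a ≡ Refl a' ∷ Id A a a
  | deq_J Γ A A1 a a1 b C C0 D C1 E d d' q q' j :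
      weak 1 A A1 -> weak 1 a a1 ->
      EVar (Id A1 a1 (Var 0 [])) :: EVar A :: Γ ⊢ C ∷ Univ j ->
      subst a 1 C C0 -> subst (Refl a) 0 C0 D -> Γ ⊢ d ≡ d' ∷ D ->
      Γ ⊢ a ∷ A -> Γ ⊢ b ∷ A -> Γ ⊢ q ≡ q' ∷ Id A a b ->
      subst b 1 C C1 -> subst q 0 C1 E ->
      Γ ⊢ J d q ≡ J d' q' ∷ E

  | deq_sqrt Γ A A' i :
      ELock :: Γ ⊢ A ≡ A' ∷ Univ i ->
      Γ ⊢ Sqrt A ≡ Sqrt A' ∷ Univ i
  | deq_lock Γ A a a' :
      ELock :: Γ ⊢ a ≡ a' ∷ A ->
      Γ ⊢ Lock a ≡ Lock a' ∷ Sqrt A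
  | deq_ev Γ A r r' :
      EVar Tiny :: Γ ⊢ r ≡ r' ∷ Sqrt A ->
      Γ ⊢ Ev r ≡ Ev r' ∷ unit_lock 0 0 A
where "Γ ⊢ a ≡ b ∷ A" := (equal Γ a b A).

(* Main.v *)
(** The recursor is [hind(g,h) = lock_L. λ f. ev(i. j⟨i/L⟩(f i))], where
    [j : ∏(x : A + B). √_M(P_↓(λ t. x⟨t/M⟩))] is defined by cases on [x], as
    [lock_M. g_↓(λ t. a⟨t/M⟩)] at [inl a] and [lock_M. h_↓(λ t. b⟨t/M⟩)] at [inr b].
    Its type is right because [ev] turns [λ t. (f i)⟨t/M⟩] into [λ t. f t], which is
    [f] by η; on [λ t. inl(l_↓(t))] the case distinction at [i] reduces by β, and
    [ev] turns the result into [g_↓(λ t. l_↓(t))].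

    Terms carry no type annotations, so [hind] does not mention [A], [B] and [P],
    which enter the types only through weakenings and through keys [i/L] with [i] a
    variable.  The admissibility of these renamings is therefore the only metatheorem
    needed: the typing of the reducts of [hind] under substitution and unit is
    obtained by typing them anew, in an arbitrary context. *)

Require Import Defs.
From Stdlib Require Import List Arith Lia.
Import ListNotations.

(** [counit] is a relation that also traverses its keys, so laws for iterated renamings cannot be
    read off by unfolding. The keys needed for [hind] are variables; for them the structural
    function [ren] computes the counit, and [counit_functional] turns a derivation of the expected
    result into an equation. Still, the commutation laws are proved for arbitrary counits, because
    the type of a variable is produced by one. They require the right numbers of keys, hence the
    invariant [scoped]. Two laws about unit make the types of [hind] fit. If an inserted key is [i]
    itself, eliminating [lock_M] replaces it by the key of [M]: this triangle identity gives the
    type of [a_↓], and turns [P[i/key_L]_↓] behind [M] into [P_↓] behind [L]. A term without [i]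
    merely loses its key, which makes [(f i)⟨t/M⟩] into [f t]. The second lock [M] is there because
    the summand of [f i] can be inspected only for one [i], whereas [P_↓] needs a whole function:
    the case distinction therefore targets a [√_M], where the constant function [λ t. (f i)⟨t/M⟩]
    stands in for [f] until [ev] makes it vary. *)

Lemma tm_nested_ind (Q : tm -> Prop)
    (var : forall x ts, Forall Q ts -> Q (Var x ts))
    (op : forall o us, Forall Q us -> Q (Op o us))
    (abs : forall a, Q a -> Q (Abs a))
    (labs : forall a, Q a -> Q (LAbs a)) :
  forall a, Q a.
Proof.
  fix IH 1.
  assert (IHs : forall l, Forall Q l) by
    exact (fix go l := match l with
      | [] => Forall_nil _
      | a :: l => Forall_cons a (IH a) (go l)
      end).
  intros [x ts|o us|a|a]; [apply var|apply op|apply abs|apply labs]; auto.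
Qed.

(** The generated principle gives no hypotheses for members of key lists. In the outer case the
    derivations for [ks] and [ts] are kept beside their hypotheses, since the scoping of [ks'] and
    the renaming inside the new keys are read off from them. *)
Lemma counit_nested_ind (Q : nat -> list tm -> nat -> nat -> tm -> tm -> Prop)
    (inner : forall n ts p q x ks ks', x < p ->
      Forall2 (Q n ts p q) ks ks' -> Q n ts p q (Var x ks) (Var x ks'))
    (outer : forall n ts p q x js js' ks ks' us, p <= x -> length ks = q ->
      Forall2 (Q n ts p q) js js' -> Forall2 (Q n ts p q) ks ks' ->
      Forall2 (counit n ts p q) ks ks' ->
      Forall2 (counit p ks' 0 0) ts us -> Forall2 (Q p ks' 0 0) ts us ->
      Q n ts p q (Var x (js ++ ks)) (Var (n + x) (js' ++ us ++ ks')))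
    (op : forall n ts p q o us us',
      Forall2 (Q n ts p q) us us' -> Q n ts p q (Op o us) (Op o us'))
    (abs : forall n ts p q a a', Q n ts (S p) q a a' -> Q n ts p q (Abs a) (Abs a'))
    (labs : forall n ts p q a a', Q n ts p (S q) a a' -> Q n ts p q (LAbs a) (LAbs a')) :
  forall n ts p q a a', counit n ts p q a a' -> Q n ts p q a a'.
Proof.
  fix IH 7; intros n ts p q a a' H.
  assert (IHs : forall n ts p q l l',
    Forall2 (counit n ts p q) l l' -> Forall2 (Q n ts p q) l l').
  { clear - IH.
    exact (fun n ts p q => fix go l l' HF := match HF with
      | Forall2_nil _ => Forall2_nil _
      | Forall2_cons x y h t => Forall2_cons x y (IH n ts p q x y h) (go _ _ t)
      end). }
  (* After [clear IH] only guarded hypotheses remain, so [auto] cannot close a goal by an illegal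
     recursive call. *)
  destruct H as [| | |? ? ? ? ? ? H|? ? ? ? ? ? H];
    [| | |apply IH in H|apply IH in H]; clear IH; auto.
Qed.

Lemma subst_nested_ind (Q : tm -> nat -> tm -> tm -> Prop)
    (inner : forall a p y ts ts', y < p ->
      Forall2 (Q a p) ts ts' -> Q a p (Var y ts) (Var y ts'))
    (this : forall a p ts ts' a',
      Forall2 (subst a p) ts ts' -> Forall2 (Q a p) ts ts' -> counit p ts' 0 0 a a' -> Q a p (Var p ts) a')
    (outer : forall a p y ts ts', p < y ->
      Forall2 (Q a p) ts ts' -> Q a p (Var y ts) (Var (pred y) ts'))
    (op : forall a p o us us', Forall2 (Q a p) us us' -> Q a p (Op o us) (Op o us'))
    (abs : forall a p b b', Q a (S p) b b' -> Q a p (Abs b) (Abs b'))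
    (labs : forall a p b b', Q a p b b' -> Q a p (LAbs b) (LAbs b')) :
  forall a p b b', subst a p b b' -> Q a p b b'.
Proof.
  fix IH 5; intros a p b b' H.
  assert (IHs : forall a p l l',
    Forall2 (subst a p) l l' -> Forall2 (Q a p) l l').
  { clear - IH.
    exact (fun a p => fix go l l' HF := match HF with
      | Forall2_nil _ => Forall2_nil _
      | Forall2_cons x y h t => Forall2_cons x y (IH a p x y h) (go _ _ t)
      end). }
  destruct H as [| | | |? ? ? ? H|? ? ? ? H];
    [| | | |apply IH in H|apply IH in H]; clear IH; eauto.
Qed.

(** * Scoping *)

(* [true] stands for a variable and [false] for a lock. *)
Fixpoint shape (Γ : ctx) : list bool :=
  match Γ with
  | [] => []
  | EVar _ :: Γ => true :: shape Γ
  | ELock :: Γ => false :: shape Γ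
  end.

Fixpoint nv (s : list bool) : nat :=
  match s with [] => 0 | true :: s => S (nv s) | false :: s => nv s end.

Fixpoint nl (s : list bool) : nat :=
  match s with [] => 0 | true :: s => nl s | false :: s => S (nl s) end.

(* The number of locks to the right of [x]; for [x] out of range, all locks count. *)
Fixpoint arity (s : list bool) (x : nat) : nat :=
  match s with
  | [] => 0
  | true :: s => match x with 0 => 0 | S x => arity s x end
  | false :: s => S (arity s x)
  end.

(* Only the numbers of keys are constrained: splitting a list of keys at a block of
   locks requires no bound on the variables. *)
Inductive scoped : list bool -> tm -> Prop :=
  | scoped_var s x ks :
      length ks = arity s x -> Forall (scoped s) ks -> scoped s (Var x ks)
  | scoped_op s o us : Forall (scoped s) us -> scoped s (Op o us)
  | scoped_abs s a : scoped (true :: s) a -> scoped s (Abs a)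
  | scoped_labs s a : scoped (false :: s) a -> scoped s (LAbs a).

Lemma nvars_shape Γ : nvars Γ = nv (shape Γ).
Proof. induction Γ as [|[A|] Γ IH]; cbn; auto. Qed.

Lemma nlocks_shape Γ : nlocks Γ = nl (shape Γ).
Proof. induction Γ as [|[A|] Γ IH]; cbn; auto. Qed.

Lemma shape_app Γ Γ' : shape (Γ ++ Γ') = shape Γ ++ shape Γ'.
Proof. induction Γ as [|[A|] Γ IH]; cbn; congruence. Qed.

Lemma nv_app s t : nv (s ++ t) = nv s + nv t.
Proof. induction s as [|[] s IH]; cbn; auto. Qed.

Lemma nl_app s t : nl (s ++ t) = nl s + nl t.
Proof. induction s as [|[] s IH]; cbn; auto. Qed.

Lemma arity_inner s t x : x < nv s -> arity (s ++ t) x = arity s x.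
Proof.
  revert x; induction s as [|[] s IH]; cbn; intros x H; auto; [lia|].
  destruct x; auto; apply IH; lia.
Qed.

Lemma arity_outer s t x : nv s <= x -> arity (s ++ t) x = nl s + arity t (x - nv s).
Proof.
  revert x; induction s as [|[] s IH]; cbn; intros x H; auto.
  - now rewrite Nat.sub_0_r.
  - destruct x; [lia|]; apply IH; lia.
Qed.

Lemma Forall2_transfer {X Y} (R : X -> Y -> Prop) (P : X -> Prop) (Q : Y -> Prop) l m :
  (forall x y, R x y -> P x -> Q y) -> Forall2 R l m -> Forall P l -> Forall Q m.
Proof. induction 2; inversion 1; subst; constructor; eauto. Qed.

Lemma Forall2_map2 {X Y X' Y'} (R : X -> Y -> Prop) (P : X -> Prop) (S : X' -> Y' -> Prop) f g l m :
  (forall x y, R x y -> P x -> S (f x) (g y)) ->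
  Forall2 R l m -> Forall P l -> Forall2 S (map f l) (map g m).
Proof. induction 2; inversion 1; subst; constructor; eauto. Qed.

Lemma Forall2_map_r {X Y} (R : X -> Y -> Prop) (f : X -> Y) l :
  Forall (fun x => R x (f x)) l -> Forall2 R l (map f l).
Proof. induction 1; constructor; auto. Qed.

Lemma list_split {X} (l : list X) q :
  q <= length l -> exists j k, l = j ++ k /\ length k = q.
Proof.
  intros H; exists (firstn (length l - q) l), (skipn (length l - q) l).
  rewrite firstn_skipn, length_skipn; split; auto; lia.
Qed.

Lemma Forall2_map_map {X Y Z} (R : Y -> Z -> Prop) (f : X -> Y) (g : X -> Z) l :
  Forall (fun x => R (f x) (g x)) l -> Forall2 R (map f l) (map g l).
Proof. induction 1; constructor; auto. Qed.

Lemma Forall_mp {X} (P Q : X -> Prop) l :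
  Forall (fun x => P x -> Q x) l -> Forall P l -> Forall Q l.
Proof. induction 1; inversion 1; constructor; auto. Qed.

(** An outer variable gains one key for every lock of the inserted block, and [nl s1 = length ts]
    makes the count come out. *)
Lemma scoped_counit n ts p q a a' : counit n ts p q a a' ->
  forall s s1 s0, nv s = p -> nl s = q -> nv s1 = n -> nl s1 = length ts ->
  Forall (scoped (s1 ++ s0)) ts -> scoped (s ++ s0) a -> scoped (s ++ s1 ++ s0) a'.
Proof.
  intros C; pattern n, ts, p, q, a, a'; eapply counit_nested_ind, C; clear.
  - intros n ts p q x ks ks' Hx IH s s1 s0 <- <- <- Hl Ht Ha.
    inversion Ha as [? ? ? L F| | |]; subst. rewrite arity_inner in * by lia.
    constructor.
    + rewrite arity_inner by lia. rewrite <- L. symmetry; eapply Forall2_length; eauto.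
    + eapply Forall2_transfer; [|eassumption|eassumption]; cbn; eauto.
  - intros n ts p q x js js' ks ks' us Hx Hk IHj IHk _ _ IHu s s1 s0 <- <- <- Hl Ht Ha.
    inversion Ha as [? ? ? L F| | |]; subst. rewrite arity_outer in * by lia.
    apply Forall_app in F as [Fj Fk].
    assert (Sk : Forall (scoped (s ++ s1 ++ s0)) ks')
      by (eapply Forall2_transfer; [|eassumption|eassumption]; cbn; eauto).
    pose proof (Forall2_length IHj); pose proof (Forall2_length IHk).
    pose proof (Forall2_length IHu).
    constructor.
    + rewrite !length_app in *. rewrite !arity_outer by lia.
      replace (nv s1 + x - nv s - nv s1) with (x - nv s) by lia. lia.
    + rewrite !Forall_app; repeat split; auto.
      * eapply Forall2_transfer; [|exact IHj|eassumption]; cbn; eauto.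
      * eapply Forall2_transfer; [|exact IHu|eassumption]; cbn.
        (* The new keys arise by a counit whose inserted block is [s] and whose inner part is
           empty. *)
        intros x0 y0 H2; apply (H2 [] s (s1 ++ s0)); auto; lia.
  - intros * IH s s1 s0 <- <- <- Hl Ht Ha; inversion Ha; subst; constructor.
    eapply Forall2_transfer; [|eassumption|eassumption]; cbn; eauto.
  - intros * IH s s1 s0 <- <- <- Hl Ht Ha; inversion Ha; subst; constructor.
    apply (IH (true :: s)); auto.
  - intros * IH s s1 s0 <- <- <- Hl Ht Ha; inversion Ha; subst; constructor.
    apply (IH (false :: s)); auto.
Qed.

Lemma scoped_subst a p b b' : subst a p b b' ->
  forall s s0, nv s = p -> scoped s0 a -> scoped (s ++ true :: s0) b -> scoped (s ++ s0) b'.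
Proof.
  intros C; pattern a, p, b, b'; eapply subst_nested_ind, C; clear.
  - intros a p y ts ts' Hy IH s s0 <- Ha Hb. inversion Hb as [? ? ? L F| | |]; subst.
    rewrite arity_inner in * by lia. constructor.
    + rewrite arity_inner by lia. rewrite <- L; symmetry; eapply Forall2_length; eauto.
    + eapply Forall2_transfer; [|eassumption|eassumption]; cbn; eauto.
  - intros a p ts ts' a' _ IH C s s0 <- Ha Hb. inversion Hb as [? ? ? L F| | |]; subst.
    rewrite arity_outer, Nat.sub_diag in L by lia; cbn in L; rewrite Nat.add_0_r in L.
    apply (scoped_counit _ _ _ _ _ _ C [] s s0); auto.
    + rewrite <- L; eapply Forall2_length; eauto.
    + eapply Forall2_transfer; [|eassumption|eassumption]; cbn; eauto.
  - intros a p y ts ts' Hy IH s s0 <- Ha Hb. inversion Hb as [? ? ? L F| | |]; subst.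
    destruct y as [|y]; [lia|]; cbn. rewrite arity_outer in * by lia.
    replace (S y - nv s) with (S (y - nv s)) in L by lia; cbn in L. constructor.
    + rewrite arity_outer by lia. rewrite <- L; symmetry; eapply Forall2_length; eauto.
    + eapply Forall2_transfer; [|eassumption|eassumption]; cbn; eauto.
  - intros * IH s s0 <- Ha Hb; inversion Hb; subst; constructor.
    eapply Forall2_transfer; [|eassumption|eassumption]; cbn; eauto.
  - intros * IH s s0 <- Ha Hb; inversion Hb; subst; constructor.
    apply (IH (true :: s)); auto.
  - intros * IH s s0 <- Ha Hb; inversion Hb; subst; constructor.
    apply (IH (false :: s)); auto.
Qed.

Lemma unit_lock_inner p q x ks :
  x < p -> unit_lock p q (Var x ks) = Var x (map (unit_lock p q) ks).
Proof. intros H; cbn; now rewrite (proj2 (Nat.compare_lt_iff _ _) H). Qed.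

Lemma unit_lock_this p q k ks :
  unit_lock p q (Var p (k :: ks)) = unit_lock p q k.
Proof. cbn; now rewrite Nat.compare_refl. Qed.

(** The two truncations in [unit_lock], at [length us - S q] and [length us - q], cut out a single
    key, that of the eliminated lock. *)
Lemma unit_lock_outer p q x js k ks : p < x -> length ks = q ->
  unit_lock p q (Var x (js ++ k :: ks)) =
  Var (pred x) (map (unit_lock p q) js ++ map (unit_lock p q) ks).
Proof.
  intros H L; cbn; rewrite (proj2 (Nat.compare_gt_iff _ _) H).
  rewrite map_app, length_app, !length_map; cbn [map length]; rewrite L.
  f_equal; f_equal.
  - rewrite firstn_app, length_map.
    replace (length js + S q - S q) with (length js) by lia.
    rewrite Nat.sub_diag, firstn_all2, app_nil_r; auto. rewrite length_map; lia.
  - rewrite skipn_app, length_map.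
    replace (length js + S q - q) with (S (length js)) by lia.
    rewrite skipn_all2 by (rewrite length_map; lia).
    now replace (S (length js) - length js) with 1 by lia.
Qed.

Lemma scoped_unit_lock s s0 a :
  scoped (s ++ false :: true :: s0) a -> scoped (s ++ s0) (unit_lock (nv s) (nl s) a).
Proof.
  revert s; induction a as [x ts IH|o us IH|a IH|a IH] using tm_nested_ind; intros s H;
    inversion H as [? ? ? L F|? ? ? F| |]; subst.
  - assert (F' : Forall (fun a => scoped (s ++ s0) (unit_lock (nv s) (nl s) a)) ts).
    { eapply Forall_mp; [|exact F]. eapply Forall_impl; [|exact IH]; cbn; auto. }
    destruct (Nat.lt_trichotomy x (nv s)) as [Hx|[->|Hx]].
    + rewrite unit_lock_inner by auto. rewrite arity_inner in * by auto. constructor.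
      * now rewrite length_map, arity_inner.
      * apply Forall_map; auto.
    + rewrite arity_outer, Nat.sub_diag in L by auto; cbn in L.
      (* The variable [i] has a key for the eliminated lock, so the default of [hd] is not
         reached. *)
      destruct ts as [|t ts]; cbn in L; [lia|].
      rewrite unit_lock_this. inversion F'; auto.
    + rewrite arity_outer in L by lia.
      replace (x - nv s) with (S (x - S (nv s))) in L by lia. cbn in L.
      destruct (list_split ts (S (nl s))) as (j & k & -> & Lk); [lia|].
      destruct k as [|k ks]; cbn in Lk; [lia|]. rewrite length_app in L; cbn in L.
      rewrite unit_lock_outer by lia.
      apply Forall_app in F' as [Fj Fk]; inversion Fk; subst. constructor.
      * rewrite length_app, !length_map, arity_outer by lia.
        replace (pred x - nv s) with (x - S (nv s)) by lia. lia.
      * rewrite Forall_app; split; apply Forall_map; auto.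
  - cbn; constructor. apply Forall_map. eapply Forall_mp; [|exact F].
    eapply Forall_impl; [|exact IH]; cbn; auto.
  - cbn; constructor; apply (IH (true :: s)); auto.
  - cbn; constructor; apply (IH (false :: s)); auto.
Qed.

(** * Renaming *)

(* The keys of [ren] below; [key b 0 []] is [[]] or [[Var 0 []]]. *)
Definition key (b : bool) (p : nat) (ks : list tm) : list tm :=
  if b then [Var p ks] else [].

(* [ren n b p q] is [counit n (key b 0 []) p q]. As the key is a variable, no
   traversal of keys takes place and the recursion is structural. *)
Fixpoint ren (n : nat) (b : bool) (p q : nat) (a : tm) : tm :=
  match a with
  | Var x ks =>
      let us := map (ren n b p q) ks in
      if x <? p then Var x us else
      let d := length us - q in
      Var (n + x) (firstn d us ++ key b p (skipn d us) ++ skipn d us)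
  | Op o us => Op o (map (ren n b p q) us)
  | Abs a => Abs (ren n b (S p) q a)
  | LAbs a => LAbs (ren n b p (S q) a)
  end.

Lemma ren_inner n b p q x ks :
  x < p -> ren n b p q (Var x ks) = Var x (map (ren n b p q) ks).
Proof. intros H; cbn [ren]; now rewrite (proj2 (Nat.ltb_lt _ _) H). Qed.

Lemma ren_outer n b p q x js ks : p <= x -> length ks = q ->
  ren n b p q (Var x (js ++ ks)) =
  Var (n + x) (map (ren n b p q) js ++
               key b p (map (ren n b p q) ks) ++ map (ren n b p q) ks).
Proof.
  intros H L; cbn [ren]; rewrite (proj2 (Nat.ltb_ge _ _) H).
  rewrite map_app, length_app, !length_map, L.
  replace (length js + q - q) with (length js) by lia.
  rewrite firstn_app, skipn_app, length_map, Nat.sub_diag.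
  rewrite firstn_all2, skipn_all2, app_nil_r by (rewrite length_map; lia).
  reflexivity.
Qed.

(* If [b], the key of the inserted lock is the last variable of the block. *)
Definition block (n : nat) (b : bool) (s : list bool) : Prop :=
  nv s = n /\ nl s = Nat.b2n b /\ (b = true -> exists t, s = true :: t).

Lemma scoped_ren n b s s1 s0 a : block n b s1 ->
  scoped (s ++ s0) a -> scoped (s ++ s1 ++ s0) (ren n b (nv s) (nl s) a).
Proof.
  intros (N & L1 & K); revert s.
  induction a as [x ts IH|o us IH|a IH|a IH] using tm_nested_ind; intros s H;
    inversion H as [? ? ? L F|? ? ? F| |]; subst.
  - assert (F' : Forall (fun a => scoped (s ++ s1 ++ s0) (ren (nv s1) b (nv s) (nl s) a)) ts).
    { eapply Forall_mp; [|exact F]. eapply Forall_impl; [|exact IH]; cbn; auto. }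
    destruct (Nat.lt_ge_cases x (nv s)) as [Hx|Hx].
    + rewrite ren_inner by auto. rewrite arity_inner in * by auto. constructor.
      * now rewrite length_map, arity_inner.
      * apply Forall_map; auto.
    + rewrite arity_outer in L by lia.
      destruct (list_split ts (nl s)) as (j & k & -> & Lk); [lia|].
      rewrite length_app in L; rewrite ren_outer by lia.
      apply Forall_app in F' as [Fj Fk]. apply Forall_map in Fj, Fk. constructor.
      * rewrite !length_app, !length_map, !arity_outer by lia.
        replace (nv s1 + x - nv s - nv s1) with (x - nv s) by lia.
        replace (length (key b (nv s) (map (ren (nv s1) b (nv s) (nl s)) k)))
          with (Nat.b2n b) by now destruct b.
        lia.
      * rewrite !Forall_app; repeat split; auto.
        destruct b; cbn; auto. destruct K as [t ->]; auto. repeat constructor; auto.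
        rewrite length_map, arity_outer, Nat.sub_diag by lia. cbn; lia.
  - cbn; constructor. apply Forall_map. eapply Forall_mp; [|exact F].
    eapply Forall_impl; [|exact IH]; cbn; auto.
  - cbn; constructor; apply (IH (true :: s)); auto.
  - cbn; constructor; apply (IH (false :: s)); auto.
Qed.

(** Even the empty counit has to cut the keys of an outer variable at the [q] inner locks; scoping
    guarantees that there are enough of them. *)
Lemma counit_id s s0 a : scoped (s ++ s0) a -> counit 0 [] (nv s) (nl s) a a.
Proof.
  revert s; induction a as [x ts IH|o us IH|a IH|a IH] using tm_nested_ind; intros s H;
    inversion H as [? ? ? L F|? ? ? F| |]; subst.
  - assert (F' : Forall2 (counit 0 [] (nv s) (nl s)) ts ts).
    { rewrite <- (map_id ts) at 2. apply Forall2_map_r.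
      eapply Forall_mp; [|exact F]. eapply Forall_impl; [|exact IH]; cbn; auto. }
    destruct (Nat.lt_ge_cases x (nv s)) as [Hx|Hx].
    + now constructor.
    + rewrite arity_outer in L by lia.
      destruct (list_split ts (nl s)) as (j & k & -> & Lk); [lia|].
      assert (Forall2 (counit 0 [] (nv s) (nl s)) j j /\ Forall2 (counit 0 [] (nv s) (nl s)) k k)
        as [Fj Fk].
      { clear - F'. induction j as [|y j IH]; cbn in F'; auto.
        inversion F'; subst. destruct IH; auto. }
      apply (counit_outer 0 [] (nv s) (nl s) x j j k k []); auto.
  - constructor. rewrite <- (map_id us) at 2. apply Forall2_map_r.
    eapply Forall_mp; [|exact F]. eapply Forall_impl; [|exact IH]; cbn; auto.
  - constructor; apply (IH (true :: s)); auto.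
  - constructor; apply (IH (false :: s)); auto.
Qed.

Lemma app_inj_length {X} (l m l' m' : list X) :
  l ++ m = l' ++ m' -> length l = length l' -> l = l' /\ m = m'.
Proof.
  revert l'; induction l as [|x l IH]; intros [|y l'] E L; cbn in *; try lia; auto.
  injection E as -> E; injection L as L; destruct (IH _ E L); subst; auto.
Qed.

Lemma Forall2_counit_id s l : Forall (scoped s) l -> Forall2 (counit 0 [] 0 0) l l.
Proof.
  induction 1; constructor; auto. now apply (counit_id [] s).
Qed.

(** This explains the shape of [key]: moved past [p] variables, the last variable of the block gets
    index [p] and the keys [ks] of the locks it has crossed, and those keys pass through an empty
    counit unchanged. *)
Lemma counit_key_var p ks s : Forall (scoped s) ks ->
  counit p ks 0 0 (Var 0 []) (Var p ks).
Proof.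
  intros F. pose proof (counit_outer p ks 0 0 0 [] [] [] [] ks) as H.
  cbn in H. rewrite Nat.add_0_r, app_nil_r in H.
  apply H; auto. eapply Forall2_counit_id; eauto.
Qed.

Lemma ren_counit n b s s1 s0 a : block n b s1 -> scoped (s ++ s0) a ->
  counit n (key b 0 []) (nv s) (nl s) a (ren n b (nv s) (nl s) a).
Proof.
  intros B; revert s.
  induction a as [x ts IH|o us IH|a IH|a IH] using tm_nested_ind; intros s H;
    inversion H as [? ? ? L F|? ? ? F| |]; subst.
  - assert (F' : Forall (fun a => counit n (key b 0 []) (nv s) (nl s) a
                                   (ren n b (nv s) (nl s) a)) ts).
    { eapply Forall_mp; [|exact F]. eapply Forall_impl; [|exact IH]; cbn; auto. }
    destruct (Nat.lt_ge_cases x (nv s)) as [Hx|Hx].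
    + rewrite ren_inner by auto. constructor; auto. now apply Forall2_map_r.
    + rewrite arity_outer in L by lia.
      destruct (list_split ts (nl s)) as (j & k & -> & Lk); [lia|].
      rewrite ren_outer by lia.
      apply Forall_app in F' as [Fj Fk]. apply Forall_app in F as [_ F].
      constructor; auto using Forall2_map_r.
      destruct b; constructor; auto. apply (counit_key_var _ _ (s ++ s1 ++ s0)).
      apply Forall_map. eapply Forall_impl; [|exact F].
      intros; now apply scoped_ren.
  - constructor. apply Forall2_map_r. eapply Forall_mp; [|exact F].
    eapply Forall_impl; [|exact IH]; cbn; auto.
  - constructor; apply (IH (true :: s)); auto.
  - constructor; apply (IH (false :: s)); auto.
Qed.

(** * Commutation of renaming with counit, substitution and unit *)

(** The renaming inserts its block between [s2] and [s0], to the left of the block [s1] of the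
    counit. The two insertions do not interfere, except that the keys of each are moved by the
    other. *)
Lemma counit_ren_outer n b m ts p q a a' : counit m ts p q a a' ->
  forall s s1 s2 s0, nv s = p -> nl s = q -> nv s1 = m -> nl s1 = length ts ->
  Forall (scoped (s1 ++ s2 ++ s0)) ts -> scoped (s ++ s2 ++ s0) a ->
  counit m (map (ren n b (nv (s1 ++ s2)) (nl (s1 ++ s2))) ts) p q
    (ren n b (nv (s ++ s2)) (nl (s ++ s2)) a)
    (ren n b (nv (s ++ s1 ++ s2)) (nl (s ++ s1 ++ s2)) a').
Proof.
  intros C; pattern m, ts, p, q, a, a'; eapply counit_nested_ind, C; clear - n b.
  - intros m ts p q x ks ks' Hx IH s s1 s2 s0 <- <- <- Hl Ht Ha.
    inversion Ha as [? ? ? L F| | |]; subst.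
    rewrite !ren_inner by (rewrite nv_app; lia). constructor; auto.
    eapply Forall2_map2; [|exact IH|exact F]; cbn; eauto.
  - intros m ts p q x js js' ks ks' us Hx Hk IHj IHk Ck Cu IHu s s1 s2 s0 <- <- <- Hl Ht Ha.
    inversion Ha as [? ? ? L F| | |]; subst.
    rewrite arity_outer, length_app in L by lia.
    apply Forall_app in F as [Fj Fk].
    assert (Lk : length ks = length ks') by (eapply Forall2_length; eauto).
    assert (Lj : length js = length js') by (eapply Forall2_length; eauto).
    assert (Sk : Forall (scoped (s ++ s1 ++ s2 ++ s0)) ks').
    { eapply Forall2_transfer; [|exact Ck|exact Fk]; cbn.
      intros ? ? ? ?; eapply scoped_counit; eauto. }
    assert (Mk := Forall2_map2 _ _ _ _ _ _ _ (fun x y H Px =>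
      H s s1 s2 s0 eq_refl eq_refl eq_refl Hl Ht Px) IHk Fk).
    (* The keys [us] come from [ts] by a counit over the block [s], which again lies to the right of
       the renaming, so the hypothesis applies with [s] in the role of [s1]. *)
    assert (Mu : Forall2 (counit (nv s) (map (ren n b (nv (s ++ s1 ++ s2)) (nl (s ++ s1 ++ s2))) ks') 0 0)
      (map (ren n b (nv (s1 ++ s2)) (nl (s1 ++ s2))) ts)
      (map (ren n b (nv (s ++ s1 ++ s2)) (nl (s ++ s1 ++ s2))) us)).
    { eapply Forall2_map2; [|exact IHu|exact Ht]; cbn; intros t u H St.
      apply (H [] s (s1 ++ s2) s0); auto; rewrite <- ?app_assoc; auto; lia. }
    destruct (Nat.lt_ge_cases x (nv (s ++ s2))) as [Hx'|Hx'].
    + rewrite !ren_inner by (rewrite !nv_app in *; lia).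
      rewrite !map_app. constructor; auto; [now rewrite length_map|].
      eapply Forall2_map2; [|exact IHj|exact Fj]; cbn; eauto.
    + rewrite nv_app in Hx'. rewrite arity_outer in L by lia.
      (* Beyond [s2] the keys split once more: [j] for the locks of [s0] and [k] for those of [s2],
         with the inserted key between them. *)
      destruct (list_split js (nl s2)) as (j & k & -> & Lk'); [lia|].
      apply Forall_app in Fj as [Fj Fk2].
      apply Forall2_app_inv_l in IHj as (j' & k' & IHj & IHk2 & ->).
      assert (length k = length k') by (eapply Forall2_length; eauto).
      assert (length ts = length us) by (eapply Forall2_length; eauto).
      rewrite <- !app_assoc.
      rewrite (ren_outer n b _ _ x j (k ++ ks)) by (rewrite ?nv_app, ?nl_app, ?length_app; lia).
      rewrite (ren_outer n b _ _ (nv s1 + x) j' (k' ++ us ++ ks'))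
        by (rewrite ?nv_app, ?nl_app, ?length_app; lia).
      assert (Mj := Forall2_map2 _ _ _ _ _ _ _ (fun x y H Px =>
        H s s1 s2 s0 eq_refl eq_refl eq_refl Hl Ht Px) IHj Fj).
      assert (Mk2 := Forall2_map2 _ _ _ _ _ _ _ (fun x y H Px =>
        H s s1 s2 s0 eq_refl eq_refl eq_refl Hl Ht Px) IHk2 Fk2).
      rewrite !map_app.
      replace (n + (nv s1 + x)) with (nv s1 + (n + x)) by lia.
      match goal with |- counit _ _ _ _ (Var _ (?J ++ ?K ++ ?k ++ ?l)) (Var _ (?J' ++ ?K' ++ ?k' ++ ?u ++ ?l')) =>
        replace (J ++ K ++ k ++ l) with ((J ++ K ++ k) ++ l) by (now rewrite <- !app_assoc);
        replace (J' ++ K' ++ k' ++ u ++ l') with ((J' ++ K' ++ k') ++ u ++ l') by now rewrite <- !app_assoc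
      end.
      constructor; auto; [lia|now rewrite length_map|].
      repeat apply Forall2_app; auto.
      destruct b; cbn [key]; constructor; auto.
      (* The inserted key is an outer variable for the counit too: its index grows by [nv s1], and
         it receives the keys [us]. *)
      assert (E : nv (s ++ s1 ++ s2) = nv s1 + nv (s ++ s2)) by (rewrite !nv_app; lia).
      rewrite E at 1. constructor; auto; [rewrite nv_app; lia|now rewrite length_map].
  - intros * IH s s1 s2 s0 <- <- <- Hl Ht Ha; inversion Ha; subst; cbn; constructor.
    eapply Forall2_map2; [|eassumption|eassumption]; cbn; eauto.
  - intros * IH s s1 s2 s0 <- <- <- Hl Ht Ha; inversion Ha; subst; cbn; constructor.
    apply (IH (true :: s) s1 s2 s0); auto.
  - intros * IH s s1 s2 s0 <- <- <- Hl Ht Ha; inversion Ha; subst; cbn; constructor.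
    apply (IH (false :: s) s1 s2 s0); auto.
Qed.

(* The renaming happens inside the inserted block, between [s2] and [s3]. *)
Lemma counit_ren_middle n b s1 m ts p q a a' : block n b s1 -> counit m ts p q a a' ->
  forall s s2 s3 s0 ts1 ts2, nv s = p -> nl s = q -> m = nv (s2 ++ s3) ->
  ts = ts1 ++ ts2 -> nl s3 = length ts1 -> nl s2 = length ts2 ->
  Forall (scoped (s2 ++ s3 ++ s0)) ts -> scoped (s ++ s0) a ->
  let r := map (ren n b (nv s2) (nl s2)) in
  counit (n + m) (r ts1 ++ key b (nv s2) (r ts2) ++ r ts2) p q a
    (ren n b (nv (s ++ s2)) (nl (s ++ s2)) a').
Proof.
  intros B C; pattern m, ts, p, q, a, a'; eapply counit_nested_ind, C; clear - B.
  - intros m ts p q x ks ks' Hx IH s s2 s3 s0 ts1 ts2 <- <- -> -> H1 H2 Ht Ha.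
    inversion Ha as [? ? ? L F| | |]; subst; cbn zeta.
    rewrite !ren_inner by (rewrite nv_app; lia). constructor; auto.
    rewrite <- (map_id ks).
    eapply Forall2_map2; [|exact IH|exact F]; cbn; intros ? ? H ?; apply (H s s2 s3 s0); auto.
  - intros m ts p q x js js' ks ks' us Hx Hk IHj IHk Ck Cu _ s s2 s3 s0 ts1 ts2 <- <- -> -> H1 H2 Ht Ha.
    inversion Ha as [? ? ? L F| | |]; subst; cbn zeta.
    rewrite arity_outer, length_app in L by lia.
    apply Forall_app in F as [Fj Fk].
    assert (Lk : length ks = length ks') by (eapply Forall2_length; eauto).
    assert (E : nl (s2 ++ s3) = length (ts1 ++ ts2)) by (rewrite nl_app, length_app; lia).
    assert (Sk : Forall (scoped (s ++ s2 ++ s3 ++ s0)) ks').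
    { eapply Forall2_transfer; [|exact Ck|exact Fk]; cbn. intros ? ? ? ?.
      rewrite (app_assoc s2); eapply scoped_counit; eauto; rewrite <- app_assoc; auto. }
    set (r2 := ren n b (nv s2) (nl s2)). set (r := ren n b (nv (s ++ s2)) (nl (s ++ s2))).
    assert (Mk : Forall2 (counit (n + nv (s2 ++ s3))
      (map r2 ts1 ++ key b (nv s2) (map r2 ts2) ++ map r2 ts2) (nv s) (nl s)) ks (map r ks')).
    { rewrite <- (map_id ks).
      eapply Forall2_map2; [|exact IHk|exact Fk]; cbn; intros ? ? H ?; apply (H s s2 s3 s0); auto. }
    assert (Mj : Forall2 (counit (n + nv (s2 ++ s3))
      (map r2 ts1 ++ key b (nv s2) (map r2 ts2) ++ map r2 ts2) (nv s) (nl s)) js (map r js')).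
    { rewrite <- (map_id js).
      eapply Forall2_map2; [|exact IHj|exact Fj]; cbn; intros ? ? H ?; apply (H s s2 s3 s0); auto. }
    (* Inside the keys the renaming is to the left of the crossed block [s], so the previous
       commutation suffices. *)
    assert (Mu : Forall2 (counit (nv s) (map r ks') 0 0) (map r2 (ts1 ++ ts2)) (map r us)).
    { eapply Forall2_map2; [|exact Cu|exact Ht]; cbn; intros t u H St.
      apply (counit_ren_outer n b _ _ _ _ _ _ H [] s s2 (s3 ++ s0)); auto; lia. }
    apply Forall2_app_inv_l in Cu as (u1 & u2 & Cu1 & Cu2 & ->).
    rewrite !map_app in Mu.
    assert (length ts1 = length u1) by (eapply Forall2_length; eauto).
    assert (length ts2 = length u2) by (eapply Forall2_length; eauto).
    assert (M1 : Forall2 (counit (nv s) (map r ks') 0 0) (map r2 ts1) (map r u1) /\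
                 Forall2 (counit (nv s) (map r ks') 0 0) (map r2 ts2) (map r u2)).
    { apply Forall2_app_inv_l in Mu as (v1 & v2 & V1 & V2 & V).
      pose proof (Forall2_length V1) as Lv; rewrite length_map in Lv.
      apply app_inj_length in V as [<- <-]; auto. rewrite length_map; lia. }
    destruct M1 as [M1 M2].
    replace (js' ++ (u1 ++ u2) ++ ks') with ((js' ++ u1) ++ (u2 ++ ks')) by now rewrite !app_assoc.
    pose proof (ren_outer n b (nv (s ++ s2)) (nl (s ++ s2)) (nv (s2 ++ s3) + x)
      (js' ++ u1) (u2 ++ ks')) as R; fold r in R.
    rewrite R by (rewrite ?nv_app, ?nl_app, ?length_app; lia). clear R.
    rewrite Nat.add_assoc, !map_app.
    match goal with |- counit _ _ _ _ _ (Var _ ((?j ++ ?u1) ++ ?K ++ ?u2 ++ ?k)) =>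
      replace ((j ++ u1) ++ K ++ u2 ++ k) with (j ++ (u1 ++ K ++ u2) ++ k) by now rewrite !app_assoc end.
    constructor; auto. repeat apply Forall2_app; auto.
    destruct b; cbn [key]; constructor; auto.
    replace (nv (s ++ s2)) with (nv s + nv s2) by now rewrite nv_app.
    assert (Sk' : Forall (scoped (s ++ s2 ++ s1 ++ s3 ++ s0)) (map r ks')).
    { apply Forall_map. eapply Forall_impl; [|exact Sk]; cbn; intros.
      rewrite app_assoc. apply scoped_ren; auto. now rewrite <- app_assoc. }
    (* The inserted key [Var (nv s2)] only has to cross [s], which adds [nv s] to its index and the
       keys of the locks of [s]. *)
    pose proof (counit_outer (nv s) (map r ks') 0 0 (nv s2) (map r2 ts2) (map r u2) [] [] (map r ks')) as G.
    rewrite !app_nil_r in G. apply G; auto; [lia|].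
    eapply Forall2_counit_id; eauto.
  - intros * IH s s2 s3 s0 ts1 ts2 <- <- -> -> H1 H2 Ht Ha; inversion Ha; subst; cbn; constructor.
    rewrite <- (map_id us).
    eapply Forall2_map2; [|eassumption|eassumption]; cbn; intros ? ? H ?; apply (H s s2 s3 s0); auto.
  - intros * IH s s2 s3 s0 ts1 ts2 <- <- -> -> H1 H2 Ht Ha; inversion Ha; subst; cbn; constructor.
    apply (IH (true :: s) s2 s3 s0); auto.
  - intros * IH s s2 s3 s0 ts1 ts2 <- <- -> -> H1 H2 Ht Ha; inversion Ha; subst; cbn; constructor.
    apply (IH (false :: s) s2 s3 s0); auto.
Qed.

(** At the substituted variable the result is a counit of [a] past [s], so [counit_ren_outer]
    applies there; for a variable further left, the inserted key must be substituted as well. *)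
Lemma subst_ren n d a p b b' : subst a p b b' ->
  forall s s2 s0, nv s = p -> scoped (s2 ++ s0) a -> scoped (s ++ true :: s2 ++ s0) b ->
  subst (ren n d (nv s2) (nl s2) a) p
    (ren n d (nv (s ++ true :: s2)) (nl (s ++ s2)) b)
    (ren n d (nv (s ++ s2)) (nl (s ++ s2)) b').
Proof.
  intros C; pattern a, p, b, b'; eapply subst_nested_ind, C; clear - n d.
  - intros a p y ts ts' Hy IH s s2 s0 <- Ha Hb. inversion Hb as [? ? ? L F| | |]; subst.
    rewrite !ren_inner by (rewrite ?nv_app; lia). constructor; auto.
    eapply Forall2_map2; [|exact IH|exact F]; cbn; eauto.
  - intros a p ts ts' a' S IH C s s2 s0 <- Ha Hb. inversion Hb as [? ? ? L F| | |]; subst.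
    rewrite arity_outer, Nat.sub_diag in L by lia; cbn in L; rewrite Nat.add_0_r in L.
    rewrite ren_inner by (rewrite nv_app; cbn; lia).
    econstructor.
    + eapply Forall2_map2; [|exact IH|exact F]; cbn; eauto.
    + apply (counit_ren_outer n d _ _ _ _ _ _ C [] s s2 s0); auto.
      * rewrite <- L; eapply Forall2_length; eauto.
      * eapply Forall2_transfer; [|exact S|exact F]; cbn.
        intros; eapply scoped_subst; eauto.
  - intros a p y ts ts' Hy IH s s2 s0 <- Ha Hb. inversion Hb as [? ? ? L F| | |]; subst.
    destruct y as [|y]; [lia|]; cbn [pred]. rewrite arity_outer in L by lia.
    replace (S y - nv s) with (S (y - nv s)) in L by lia; cbn in L.
    assert (M : Forall2 (subst (ren n d (nv s2) (nl s2) a) (nv s))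
        (map (ren n d (nv (s ++ true :: s2)) (nl (s ++ s2))) ts)
        (map (ren n d (nv (s ++ s2)) (nl (s ++ s2))) ts'))
      by (eapply Forall2_map2; [|exact IH|exact F]; cbn; eauto).
    assert (EV : nv (s ++ true :: s2) = S (nv (s ++ s2))) by (rewrite !nv_app; cbn; lia).
    destruct (Nat.lt_ge_cases y (nv (s ++ s2))) as [Hx|Hx].
    + rewrite !ren_inner by lia. apply (subst_outer _ _ (S y)); auto.
    + rewrite nv_app in Hx. rewrite arity_outer in L by lia.
      destruct (list_split ts (nl (s ++ s2))) as (j & k & -> & Lk); [rewrite nl_app; lia|].
      apply Forall2_app_inv_l in IH as (j' & k' & IHj & IHk & ->).
      assert (length k = length k') by (eapply Forall2_length; eauto).
      assert (length j = length j') by (eapply Forall2_length; eauto).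
      rewrite !ren_outer by (rewrite ?nv_app in *; lia).
      rewrite !map_app in M.
      apply Forall2_app_inv_l in M as (v1 & v2 & V1 & V2 & V).
      pose proof (Forall2_length V1) as Lv; rewrite length_map in Lv.
      apply app_inj_length in V as [<- <-]; [|rewrite length_map; lia].
      replace (n + y) with (pred (n + S y)) by lia.
      apply subst_outer; [lia|]. repeat apply Forall2_app; auto.
      destruct d; cbn [key]; constructor; auto.
      rewrite EV in *. apply (subst_outer _ _ (S _)); auto. rewrite nv_app; lia.
  - intros * IH s s2 s0 <- Ha Hb; inversion Hb; subst; cbn; constructor.
    eapply Forall2_map2; [|eassumption|eassumption]; cbn; eauto.
  - intros * IH s s2 s0 <- Ha Hb; inversion Hb; subst; cbn; constructor.
    apply (IH (true :: s) s2 s0); auto.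
  - intros * IH s s2 s0 <- Ha Hb; inversion Hb; subst; cbn; constructor.
    apply (IH (false :: s) s2 s0); auto.
Qed.

Lemma map_map_Forall {X Y Y' Z} (f : Y -> Z) (g : X -> Y) (f' : Y' -> Z) (g' : X -> Y') l :
  Forall (fun x => f (g x) = f' (g' x)) l -> map f (map g l) = map f' (map g' l).
Proof. induction 1; cbn; congruence. Qed.

(** The insertion lies to the left of [i], so [i] and its lock are untouched by it; only the copies
    of keys in the inserted key need care. *)
Lemma unit_lock_ren n b s s2 s0 a : scoped (s ++ false :: true :: s2 ++ s0) a ->
  unit_lock (nv s) (nl s)
    (ren n b (nv (s ++ false :: true :: s2)) (nl (s ++ false :: true :: s2)) a) =
  ren n b (nv (s ++ s2)) (nl (s ++ s2)) (unit_lock (nv s) (nl s) a).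
Proof.
  revert s; induction a as [x ts IH|o us IH|a IH|a IH] using tm_nested_ind; intros s H;
    inversion H as [? ? ? L F|? ? ? F| |]; subst.
  - assert (E : Forall (fun a => unit_lock (nv s) (nl s)
        (ren n b (nv (s ++ false :: true :: s2)) (nl (s ++ false :: true :: s2)) a) =
        ren n b (nv (s ++ s2)) (nl (s ++ s2)) (unit_lock (nv s) (nl s) a)) ts).
    { eapply Forall_mp; [|exact F]. eapply Forall_impl; [|exact IH]; cbn; auto. }
    assert (EV : nv (s ++ false :: true :: s2) = S (nv (s ++ s2)))
      by (rewrite !nv_app; cbn; lia).
    assert (EL : nl (s ++ false :: true :: s2) = S (nl (s ++ s2)))
      by (rewrite !nl_app; cbn; lia).
    destruct (Nat.lt_trichotomy x (nv s)) as [Hx|[->|Hx]].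
    + rewrite ren_inner, !unit_lock_inner, ren_inner by (rewrite ?nv_app; lia).
      f_equal; now apply map_map_Forall.
    + rewrite arity_outer, Nat.sub_diag in L by auto; cbn in L.
      destruct ts as [|t ts]; cbn in L; [lia|].
      rewrite ren_inner by (rewrite nv_app; cbn; lia).
      cbn [map]; rewrite !unit_lock_this. now inversion E.
    + rewrite arity_outer in L by lia.
      replace (x - nv s) with (S (x - S (nv s))) in L by lia. cbn in L.
      destruct (Nat.lt_ge_cases x (nv (s ++ false :: true :: s2))) as [Hx'|Hx'].
      * destruct (list_split ts (S (nl s))) as (j & k & -> & Lk); [lia|].
        destruct k as [|k ks]; cbn in Lk; [lia|].
        apply Forall_app in E as [Ej Ek]; inversion_clear Ek.
        rewrite unit_lock_outer, !ren_inner by lia.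
        rewrite map_app; cbn [map]; rewrite unit_lock_outer by (rewrite ?length_map; lia).
        rewrite map_app. f_equal; f_equal; now apply map_map_Forall.
      * rewrite arity_outer in L by (rewrite EV, nv_app in Hx'; lia).
        destruct (list_split ts (nl (s ++ false :: true :: s2))) as (j & k & -> & Lk);
          [rewrite nl_app; cbn; lia|].
        (* From left to right, the keys belong to [s0] ([j]), to [s2] ([j2]), to the eliminated lock
           ([k2]) and to [s] ([ks]). *)
        destruct (list_split k (S (nl s))) as (j2 & k2 & -> & Lk2); [rewrite Lk, EL, nl_app; lia|].
        destruct k2 as [|k2 ks]; cbn in Lk2; [lia|].
        apply Forall_app in E as [Ej Ek]; apply Forall_app in Ek as [Ej2 Ek]; inversion_clear Ek.
        rewrite ren_outer by auto.
        rewrite length_app in Lk; cbn in Lk.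
        assert (R : unit_lock (nv s) (nl s) (Var x (j ++ j2 ++ k2 :: ks)) =
          Var (pred x) (map (unit_lock (nv s) (nl s)) j ++
            map (unit_lock (nv s) (nl s)) j2 ++ map (unit_lock (nv s) (nl s)) ks)).
        { rewrite app_assoc, unit_lock_outer, map_app, <- app_assoc by lia. reflexivity. }
        rewrite R, ren_outer by (rewrite ?length_app, ?length_map; lia).
        rewrite !map_app; cbn [map].
        rewrite !app_assoc, unit_lock_outer by (rewrite ?length_map; lia).
        rewrite !map_app, <- !app_assoc.
        replace (pred (n + x)) with (n + pred x) by lia.
        apply map_map_Forall in Ej, Ej2, H1. rewrite Ej, Ej2, H1.
        destruct b; cbn [key map app]; auto.
        (* The inserted key carries its own copy of [j2 ++ k2 :: ks], from which [k2] disappears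
           too. *)
        rewrite EV in *. rewrite unit_lock_outer by (rewrite ?nv_app, ?length_map; lia).
        cbn [pred]. now rewrite Ej2, H1.
  - cbn; f_equal. apply map_map_Forall. eapply Forall_mp; [|exact F].
    eapply Forall_impl; [|exact IH]; cbn; auto.
  - cbn; f_equal; apply (IH (true :: s)); auto.
  - cbn; f_equal; apply (IH (false :: s)); auto.
Qed.

(** A triangle identity of the adjunction. The inserted lock has the key [i], which itself has the
    key [k] of the old lock; eliminating the old lock replaces [i] by [k]. So the new lock takes
    over the role of the old one, and only [n] weakenings remain. *)
Lemma unit_lock_ren_key n s s0 a : scoped (s ++ false :: s0) a ->
  unit_lock (nv s) (nl s) (ren (S n) true (nv s) (S (nl s)) a) =
  ren n false (nv s) (nl s) a.
Proof.
  revert s; induction a as [x ts IH|o us IH|a IH|a IH] using tm_nested_ind; intros s H;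
    inversion H as [? ? ? L F|? ? ? F| |]; subst.
  - assert (E : Forall (fun a => unit_lock (nv s) (nl s) (ren (S n) true (nv s) (S (nl s)) a) =
      ren n false (nv s) (nl s) a) ts).
    { eapply Forall_mp; [|exact F]. eapply Forall_impl; [|exact IH]; cbn; auto. }
    assert (E' : forall l, Forall (fun a => unit_lock (nv s) (nl s) (ren (S n) true (nv s) (S (nl s)) a) =
      ren n false (nv s) (nl s) a) l -> map (unit_lock (nv s) (nl s)) (map (ren (S n) true (nv s) (S (nl s))) l) =
      map (ren n false (nv s) (nl s)) l).
    { intros l G. rewrite map_map. apply map_ext_Forall; auto. }
    destruct (Nat.lt_ge_cases x (nv s)) as [Hx|Hx].
    + rewrite !ren_inner, unit_lock_inner by auto. f_equal; auto.
    + rewrite arity_outer in L by lia; cbn in L.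
      destruct (list_split ts (S (nl s))) as (j & k & -> & Lk); [lia|].
      rewrite ren_outer by auto.
      destruct k as [|k ks]; cbn in Lk; [lia|]. cbn [map key].
      apply Forall_app in E as [Ej Ek]; inversion_clear Ek.
      rewrite (app_assoc (map _ j)), unit_lock_outer by (rewrite ?length_map; lia).
      rewrite map_app; cbn [map]; rewrite unit_lock_this.
      replace (j ++ k :: ks) with ((j ++ [k]) ++ ks) by now rewrite <- app_assoc.
      rewrite ren_outer by lia. rewrite !E', map_app by auto. cbn [map key app].
      now rewrite H0.
  - cbn; f_equal. rewrite map_map. apply map_ext_Forall. eapply Forall_mp; [|exact F].
    eapply Forall_impl; [|exact IH]; cbn; auto.
  - cbn; f_equal; apply (IH (true :: s)); auto.
  - cbn; f_equal; apply (IH (false :: s)); auto.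
Qed.

(* In [Γ, i : T, lock_M, t : T], eliminating [lock_M] undoes the key [t/M], even though
   [t] is not [i]: no variable of [Γ] mentions [i]. *)
Lemma unit_lock_key s s0 a : scoped (s ++ s0) a ->
  unit_lock (S (nv s)) (nl s) (ren 2 true (nv s) (nl s) a) = ren 1 false (nv s) (nl s) a.
Proof.
  revert s; induction a as [x ts IH|o us IH|a IH|a IH] using tm_nested_ind; intros s H;
    inversion H as [? ? ? L F|? ? ? F| |]; subst.
  - assert (E : map (unit_lock (S (nv s)) (nl s)) (map (ren 2 true (nv s) (nl s)) ts) =
      map (ren 1 false (nv s) (nl s)) ts).
    { rewrite map_map. apply map_ext_Forall. eapply Forall_mp; [|exact F].
      eapply Forall_impl; [|exact IH]; cbn; auto. }
    destruct (Nat.lt_ge_cases x (nv s)) as [Hx|Hx].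
    + rewrite !ren_inner, unit_lock_inner by lia. f_equal; auto.
    + rewrite arity_outer in L by lia.
      destruct (list_split ts (nl s)) as (j & k & -> & Lk); [lia|].
      rewrite !ren_outer by auto. cbn [key].
      rewrite !map_app in E. apply app_inj_length in E as [Ej Ek]; [|now rewrite !length_map].
      cbn [app]. rewrite unit_lock_outer by (rewrite ?length_map; lia).
      now rewrite Ej, Ek.
  - cbn; f_equal. rewrite map_map. apply map_ext_Forall. eapply Forall_mp; [|exact F].
    eapply Forall_impl; [|exact IH]; cbn; auto.
  - cbn; f_equal; apply (IH (true :: s)); auto.
  - cbn; f_equal; apply (IH (false :: s)); auto.
Qed.

Lemma subst_weak a s s0 b : scoped (s ++ s0) b ->
  subst a (nv s) (ren 1 false (nv s) (nl s) b) b.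
Proof.
  revert s; induction b as [x ts IH|o us IH|b IH|b IH] using tm_nested_ind; intros s H;
    inversion H as [? ? ? L F|? ? ? F| |]; subst.
  - assert (E : Forall2 (subst a (nv s)) (map (ren 1 false (nv s) (nl s)) ts) ts).
    { rewrite <- (map_id ts) at 2. apply Forall2_map_map. eapply Forall_mp; [|exact F].
      eapply Forall_impl; [|exact IH]; cbn; auto. }
    destruct (Nat.lt_ge_cases x (nv s)) as [Hx|Hx].
    + rewrite ren_inner by auto. now constructor.
    + rewrite arity_outer in L by lia.
      destruct (list_split ts (nl s)) as (j & k & -> & Lk); [lia|].
      rewrite ren_outer by auto; cbn [key app]. rewrite <- map_app.
      apply (subst_outer _ _ (S x)); auto. lia.
  - cbn; constructor. rewrite <- (map_id us) at 2. apply Forall2_map_map.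
    eapply Forall_mp; [|exact F]. eapply Forall_impl; [|exact IH]; cbn; auto.
  - cbn; constructor; apply (IH (true :: s)); auto.
  - cbn; constructor; apply (IH (false :: s)); auto.
Qed.

Lemma block_key n : block (S n) true (repeat true (S n) ++ [false]).
Proof.
  repeat split; [rewrite nv_app|rewrite nl_app|now eexists]; cbn; induction n; cbn; auto.
Qed.

(** The key is the last variable of the block. Replacing it by the variable before it gives the same
    passage with a block one shorter, keyed by that variable; this is what applying a [λ t] to a
    variable [t] does. *)
Lemma subst_key n s s0 b : scoped (s ++ s0) b ->
  subst (Var 0 []) (nv s) (ren (S (S n)) true (nv s) (nl s) b) (ren (S n) true (nv s) (nl s) b).
Proof.
  revert s; induction b as [x ts IH|o us IH|b IH|b IH] using tm_nested_ind; intros s H;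
    inversion H as [? ? ? L F|? ? ? F| |]; subst.
  - assert (E : Forall (fun b => subst (Var 0 []) (nv s) (ren (S (S n)) true (nv s) (nl s) b)
        (ren (S n) true (nv s) (nl s) b)) ts).
    { eapply Forall_mp; [|exact F]. eapply Forall_impl; [|exact IH]; cbn; auto. }
    destruct (Nat.lt_ge_cases x (nv s)) as [Hx|Hx].
    + rewrite !ren_inner by auto. constructor; auto. now apply Forall2_map_map.
    + rewrite arity_outer in L by lia.
      destruct (list_split ts (nl s)) as (j & k & -> & Lk); [lia|].
      apply Forall_app in F as [Fj Fk]; apply Forall_app in E as [Ej Ek].
      apply Forall2_map_map in Ej, Ek.
      rewrite !ren_outer by auto; cbn [key].
      apply (subst_outer _ _ (S (S n) + x)); [lia|].
      repeat apply Forall2_app; auto. constructor; auto.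
      econstructor; [exact Ek|].
      eapply counit_key_var, Forall_map, Forall_impl; [|exact Fk]. cbn; intros b Sb.
      apply scoped_ren; eauto using block_key.
  - cbn; constructor; apply Forall2_map_map. eapply Forall_mp; [|exact F].
    eapply Forall_impl; [|exact IH]; cbn; auto.
  - cbn; constructor; apply (IH (true :: s)); auto.
  - cbn; constructor; apply (IH (false :: s)); auto.
Qed.

(** Both sides are values of the same counit: the left one by [counit_ren_outer], the right one
    because [ren] computes it. *)
Lemma ren_ren_outer n b m b' s s1 s2 s3 s0 a : block m b' s1 -> block n b s3 ->
  scoped (s ++ s2 ++ s0) a ->
  ren n b (nv (s ++ s1 ++ s2)) (nl (s ++ s1 ++ s2)) (ren m b' (nv s) (nl s) a) =
  ren m b' (nv s) (nl s) (ren n b (nv (s ++ s2)) (nl (s ++ s2)) a).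
Proof.
  intros B1 B3 H. pose proof B1 as (N & L & K).
  assert (Hk : Forall (scoped (s1 ++ s2 ++ s0)) (key b' 0 [])).
  { destruct b'; cbn; auto. destruct K as [t ->]; auto. repeat constructor. }
  eapply (counit_functional m (key b' 0 [])).
  - assert (E : map (ren n b (nv (s1 ++ s2)) (nl (s1 ++ s2))) (key b' 0 []) = key b' 0 []).
    { destruct b'; cbn [key map]; auto. rewrite ren_inner; auto.
      destruct K as [t ->]; auto; cbn; lia. }
    rewrite <- E at 1. eapply counit_ren_outer; eauto; try (now destruct b').
    eapply ren_counit; eauto.
  - eapply ren_counit with (s0 := s2 ++ s3 ++ s0); eauto. rewrite app_assoc.
    apply scoped_ren; auto. now rewrite <- app_assoc.
Qed.

(** The side conditions ensure that the merged block has at most one lock with its key in last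
    place: an inserted key must come last already ([s2 = []]), and an earlier key must stay to the
    right of the insertion ([s2 <> []]). *)
Lemma ren_ren_middle n b m b' s s1 s2 s3 s0 a : block n b s1 -> block m b' (s2 ++ s3) ->
  nl s2 = 0 -> (b = true -> s2 = [] /\ b' = false) -> (b' = true -> s2 <> []) ->
  scoped (s ++ s0) a ->
  ren n b (nv (s ++ s2)) (nl s) (ren m b' (nv s) (nl s) a) =
  ren (n + m) (b || b') (nv s) (nl s) a.
Proof.
  intros B1 B2 L2 Hb Hb' H. pose proof B1 as (N & L & K). pose proof B2 as (N' & L' & K').
  assert (Hk : Forall (scoped (s2 ++ s3 ++ s0)) (key b' 0 [])).
  { rewrite app_assoc. destruct b'; cbn; auto. destruct K' as [t ->]; auto. repeat constructor. }
  assert (E : map (ren n b (nv s2) (nl s2)) (key b' 0 []) ++ key b (nv s2) [] ++ [] =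
    key (b || b') 0 []).
  { destruct b, b'; cbn -[ren]; auto; try (destruct Hb; [auto|]; subst; auto; discriminate).
    rewrite ren_inner; auto. destruct s2 as [|[] s2]; cbn in *; try lia; now destruct Hb'. }
  replace (nl s) with (nl (s ++ s2)) at 1 by (rewrite nl_app; lia).
  eapply (counit_functional (n + m) (key (b || b') 0 [])).
  - rewrite <- E at 1. eapply (counit_ren_middle n b s1 m (key b' 0 [])) with (ts2 := []) (s3 := s3) (s0 := s0); eauto.
    + eapply ren_counit; eauto.
    + symmetry; apply app_nil_r.
    + rewrite nl_app in L'; destruct b'; cbn in *; lia.
  - eapply ren_counit with (s1 := s2 ++ s1 ++ s3); eauto.
    rewrite nv_app in N'; rewrite nl_app in L'. repeat split.
    + rewrite !nv_app; lia.
    + rewrite !nl_app. destruct b, b'; cbn in *; lia.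
    + destruct b; cbn; intros Eb.
      * destruct Hb as [-> _], K as [t ->]; auto. now eexists.
      * destruct s2; [now destruct Hb'|]. destruct K' as [t E']; auto.
        injection E' as -> _. now eexists.
Qed.

(* Judgements involve only scoped terms *)
Scheme wf_mind := Minimality for wf Sort Prop
  with typing_mind := Minimality for typing Sort Prop
  with equal_mind := Minimality for equal Sort Prop.
Combined Scheme judgement_ind from wf_mind, typing_mind, equal_mind.

Ltac scoped_inv := repeat match goal with
  | H : _ /\ _ |- _ => destruct H
  | H : scoped _ (Op _ _) |- _ => inversion H; clear H; subst
  | H : scoped _ (Abs _) |- _ => inversion H; clear H; subst
  | H : scoped _ (LAbs _) |- _ => inversion H; clear H; subst
  | H : Forall _ (_ :: _) |- _ => inversion H; clear H; subst
  end.

Lemma Forall_nth_error {X} (P : X -> Prop) l :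
  (forall m x, nth_error l m = Some x -> P x) -> Forall P l.
Proof.
  intros H; apply Forall_forall; intros x Hx.
  apply In_nth_error in Hx as [m E]; eauto.
Qed.

(** This supplies the scoping hypotheses of all commutation laws. The statement about contexts is
    needed for the type of a variable, which has no typing premise of its own. *)
Lemma judgement_scoped :
  (forall Γ, wf Γ -> forall Γ1 A Γ0, Γ = Γ1 ++ EVar A :: Γ0 -> scoped (shape Γ0) A) /\
  (forall Γ a A, Γ ⊢ a ∷ A -> scoped (shape Γ) a /\ scoped (shape Γ) A) /\
  (forall Γ a b A, Γ ⊢ a ≡ b ∷ A ->
    scoped (shape Γ) a /\ scoped (shape Γ) b /\ scoped (shape Γ) A).
Proof.
  assert (S0 : forall s a b b', scoped s a -> scoped (true :: s) b -> subst a 0 b b' ->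
    scoped s b') by (intros; eapply (scoped_subst _ _ _ _ H1 []); eauto).
  assert (S1 : forall s x a b b', scoped s a -> scoped (x :: true :: s) b -> subst a 1 b b' ->
    x = true -> scoped (x :: s) b')
    by (intros; subst; eapply (scoped_subst _ _ _ _ H1 [true]); eauto).
  assert (U0 : forall s a, scoped (false :: true :: s) a -> scoped s (unit_lock 0 0 a))
    by (intros; now apply (scoped_unit_lock [])).
  assert (K1 : forall s a a', scoped s a -> keyed 1 a a' -> scoped (true :: false :: s) a').
  { intros. eapply (scoped_counit _ _ _ _ _ _ H0 [] [true; false]); auto. repeat constructor. }
  assert (W1 : forall s a a', scoped s a -> weak 1 a a' -> scoped (true :: s) a').
  { intros. eapply (scoped_counit _ _ _ _ _ _ H0 [] [true]); auto. }
  apply judgement_ind; intros; scoped_inv;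
    try (repeat split; auto; repeat constructor; auto; fail);
    try (repeat split; repeat constructor; eauto; fail).
  - destruct Γ1; discriminate.
  - destruct Γ1 as [|e Γ1]; inversion H3; subst; eauto.
  - destruct Γ1 as [|e Γ1]; inversion H1; subst; eauto.
  - rewrite shape_app, nvars_shape in *; rewrite nlocks_shape in *.
    assert (Forall (scoped (shape Γ' ++ shape (EVar A :: Γ))) ts)
      by (apply Forall_forall; intros t Ht; apply (H3 t Ht)).
    split.
    + constructor; auto. rewrite arity_outer, Nat.sub_diag by lia; cbn; lia.
    + pose proof (H0 _ _ _ eq_refl).
      assert (E : shape Γ' ++ shape (EVar A :: Γ) = (shape Γ' ++ [true]) ++ shape Γ)
        by now rewrite <- app_assoc.
      rewrite E in *. eapply (scoped_counit _ _ _ _ _ _ H4 []); auto.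
      * rewrite nv_app; cbn; lia.
      * rewrite nl_app; cbn; lia.
  - split; [repeat constructor; auto|]. eapply S0; [| |eassumption]; repeat constructor; auto.
  - split; [|split]; [repeat constructor; auto| |];
      (eapply S0; [| |eassumption]; repeat constructor; auto).
  - split; [|split]; [repeat constructor; auto| |];
      (eapply S0; [| |eassumption]; repeat constructor; auto).
  - repeat split; auto. inversion H0; subst. constructor; [congruence|].
    apply Forall_nth_error; intros m t' E.
    destruct (nth_error ts m) as [t|] eqn:Et.
    + eapply H3; eauto.
    + apply nth_error_None in Et. assert (m < length ts') by (apply nth_error_Some; congruence). lia.
  - split; [|split]; [repeat constructor; auto..|].
    eapply S0; [| |eassumption]; repeat constructor; auto.
Qed.

(** * Admissibility of renaming *)

Definition insertion (n : nat) (b : bool) (Γ : ctx) : Prop :=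
  nvars Γ = n /\ nlocks Γ = Nat.b2n b /\ (b = true -> exists Δ, Γ = EVar Tiny :: Δ).

Definition ren_past (n : nat) (b : bool) (Γ : ctx) (a : tm) : tm :=
  ren n b (nv (shape Γ)) (nl (shape Γ)) a.

Fixpoint ren_ctx (n : nat) (b : bool) (Γ : ctx) : ctx :=
  match Γ with
  | [] => []
  | EVar A :: Γ => EVar (ren_past n b Γ A) :: ren_ctx n b Γ
  | ELock :: Γ => ELock :: ren_ctx n b Γ
  end.

Lemma insertion_block n b Γ : insertion n b Γ -> block n b (shape Γ).
Proof.
  intros (N & L & K). rewrite nvars_shape in N; rewrite nlocks_shape in L.
  repeat split; auto. intros E; destruct (K E) as [Δ ->]; now eexists.
Qed.

Lemma shape_ren_ctx n b Γ : shape (ren_ctx n b Γ) = shape Γ.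
Proof. induction Γ as [|[] Γ IH]; cbn; congruence. Qed.

Lemma ren_ctx_app n b Γ1 Γ2 :
  exists Γ3, ren_ctx n b (Γ1 ++ Γ2) = Γ3 ++ ren_ctx n b Γ2 /\ shape Γ3 = shape Γ1.
Proof.
  induction Γ1 as [|[A|] Γ1 (Γ3 & E & S)]; cbn; [now exists []| |]; rewrite E.
  - exists (EVar (ren_past n b (Γ1 ++ Γ2) A) :: Γ3); cbn; now rewrite S.
  - exists (ELock :: Γ3); cbn; now rewrite S.
Qed.

Lemma Forall2_nth_error {X Y} (R : X -> Y -> Prop) l l' : length l = length l' ->
  (forall m x y, nth_error l m = Some x -> nth_error l' m = Some y -> R x y) ->
  Forall2 R l l'.
Proof.
  revert l'; induction l as [|x l IH]; intros [|y l'] L H; cbn in *; try discriminate; auto.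
  constructor; [apply (H 0); auto|apply IH; auto]. intros m; apply (H (S m)).
Qed.

Lemma Forall2_nth_error_inv {X Y} (R : X -> Y -> Prop) l l' : Forall2 R l l' ->
  forall m x y, nth_error l m = Some x -> nth_error l' m = Some y -> R x y.
Proof.
  induction 1; intros [|m] x' y' E E'; cbn in *; try discriminate; eauto. congruence.
Qed.

Lemma var_keys Γ a A : Γ ⊢ a ∷ A ->
  forall x ts, a = Var x ts -> forall t, In t ts -> Γ ⊢ t ∷ Tiny.
Proof. induction 1; intros y us Eq; try discriminate; eauto. inversion Eq; subst; auto. Qed.

Lemma deq_keys Γ x ts ts' A : Γ ⊢ Var x ts ∷ A ->
  Forall2 (fun t t' => Γ ⊢ t ≡ t' ∷ Tiny) ts ts' -> Γ ⊢ Var x ts ≡ Var x ts' ∷ A.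
Proof.
  intros T F. apply deq_var; auto.
  - eapply Forall2_length; eauto.
  - now apply Forall2_nth_error_inv.
Qed.

(** A variable to the right of the insertion keeps its index, and its type is treated by
    [counit_ren_outer]. For a variable to the left, the insertion falls inside the block that its
    type crosses, which is [counit_ren_middle]. *)
Lemma ren_var_typed n b Γ0 Γ' Γ1 Γa Γb A A' ts :
  wf (ren_ctx n b Γ1 ++ Γ' ++ Γ0) -> insertion n b Γ' ->
  Γb ++ EVar A :: Γa = Γ1 ++ Γ0 ->
  scoped (shape Γa) A -> Forall (scoped (shape (Γ1 ++ Γ0))) ts ->
  length ts = nlocks Γb ->
  (forall t, In t ts -> ren_ctx n b Γ1 ++ Γ' ++ Γ0 ⊢ ren_past n b Γ1 t ∷ Tiny) ->
  counit (S (nvars Γb)) ts 0 0 A A' ->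
  ren_ctx n b Γ1 ++ Γ' ++ Γ0 ⊢ ren_past n b Γ1 (Var (nvars Γb) ts) ∷ ren_past n b Γ1 A'.
Proof.
  intros W I E SA St L T C. rewrite nvars_shape, nlocks_shape in *.
  pose proof (insertion_block _ _ _ I) as B.
  assert (Cases : (exists Γc, Γ1 = Γb ++ EVar A :: Γc /\ Γa = Γc ++ Γ0) \/
                  (exists Γc, Γb = Γ1 ++ Γc /\ Γ0 = Γc ++ EVar A :: Γa)).
  { destruct (app_eq_app _ _ _ _ E) as [[|e l] [[E1 E2]|[E1 E2]]]; eauto.
    - right; exists []; rewrite app_nil_r in *; auto.
    - inversion E2; subst; eauto. }
  destruct Cases as [(Γc & -> & ->)|(Γc & -> & ->)]; clear E.
  - destruct (ren_ctx_app n b Γb (EVar A :: Γc)) as (Γd & E & S). cbn in E.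
    rewrite E, <- app_assoc in *; cbn [app] in *.
    assert (R : ren_past n b (Γb ++ EVar A :: Γc) (Var (nv (shape Γb)) ts) =
      Var (nvars Γd) (map (ren_past n b (Γb ++ EVar A :: Γc)) ts)).
    { unfold ren_past. rewrite ren_inner, nvars_shape, S; auto.
      rewrite shape_app, nv_app; cbn; lia. }
    rewrite R.
    apply ty_var with (A := ren_past n b Γc A); auto.
    + rewrite length_map, nlocks_shape; congruence.
    + intros t Ht; apply in_map_iff in Ht as (u & <- & Hu); auto.
    + rewrite nvars_shape, S. unfold ren_past. rewrite shape_app in *.
      replace (shape Γb ++ shape (EVar A :: Γc)) with ((shape Γb ++ [true]) ++ shape Γc)
        by now rewrite <- app_assoc.
      apply (counit_ren_outer n b _ _ _ _ _ _ C [] (shape Γb ++ [true]) (shape Γc) (shape Γ0));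
        auto; rewrite ?nv_app, ?nl_app; cbn; try lia.
      rewrite <- !app_assoc; cbn. cbn in St; now rewrite shape_app in St.
  - rewrite shape_app in *.
    assert (Ln : nv (shape Γ') = n /\ nl (shape Γ') = Nat.b2n b) by (destruct B as (? & ? & _); auto).
    destruct (list_split ts (nl (shape Γ1))) as (j & k & -> & Lk); [rewrite L, nl_app; lia|].
    pose proof (ren_outer n b (nv (shape Γ1)) (nl (shape Γ1))
      (nv (shape Γ1 ++ shape Γc)) j k) as R.
    change (ren n b (nv (shape Γ1)) (nl (shape Γ1))) with (ren_past n b Γ1) in R.
    rewrite R by (rewrite ?nv_app; lia). clear R.
    set (Θ := ren_ctx n b Γ1 ++ Γ' ++ Γc).
    assert (E : ren_ctx n b Γ1 ++ Γ' ++ Γc ++ EVar A :: Γa = Θ ++ EVar A :: Γa)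
      by (unfold Θ; now rewrite <- !app_assoc).
    rewrite E in *.
    assert (EV : nvars Θ = n + nv (shape Γ1 ++ shape Γc)).
    { unfold Θ; rewrite nvars_shape, !shape_app, !nv_app, shape_ren_ctx; lia. }
    rewrite <- EV. eapply ty_var; eauto.
    + rewrite !length_app, !length_map in *.
      unfold Θ; rewrite nlocks_shape, !shape_app, !nl_app, shape_ren_ctx in *.
      destruct b; cbn in *; lia.
    + intros t Ht; rewrite !in_app_iff, !in_map_iff in Ht.
      destruct Ht as [(u & <- & Hu)|[Ht|(u & <- & Hu)]]; [apply T, in_app_iff; auto| |apply T, in_app_iff; auto].
      destruct b; [|destruct Ht]. destruct Ht as [<-|[]].
      destruct I as (_ & _ & K). destruct K as (Γe & ->); auto.
      (* The inserted key is the last variable of [Γ'], of type [Tiny] by [insertion]; its own keys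
         are the renamed [k], for the locks of [Γ1]. *)
      assert (E3 : Θ ++ EVar A :: Γa = ren_ctx n true Γ1 ++ EVar Tiny :: Γe ++ Γc ++ EVar A :: Γa).
      { unfold Θ; rewrite <- app_assoc; cbn; now rewrite <- app_assoc. }
      rewrite E3 in *. rewrite <- (shape_ren_ctx n true Γ1), <- nvars_shape. eapply ty_var; auto.
      * rewrite length_map, nlocks_shape, shape_ren_ctx; auto.
      * intros t Ht; apply in_map_iff in Ht as (u & <- & Hu). apply T, in_app_iff; auto.
      * apply (counit_op _ _ _ _ OTiny); auto.
    (* The crossed block includes the variable itself, hence the successor and the [[true]] at its
       left end. *)
    + rewrite EV. rewrite <- Nat.add_succ_r.
      apply (counit_ren_middle n b _ _ _ _ _ _ _ B C [] (shape Γ1) (shape Γc ++ [true]) (shape Γa));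
        auto; rewrite ?nv_app, ?nl_app, ?length_app in *; cbn; try lia.
      rewrite <- app_assoc; cbn. now rewrite shape_app in St.
Qed.

(** The inserted key contains copies of the keys [k] and so changes along with them; its typing is
    extracted from that of the whole variable by [var_keys]. *)
Lemma ren_var_equal n b p q Θ x ts ts' A : Θ ⊢ ren n b p q (Var x ts) ∷ A ->
  length ts = length ts' ->
  (forall m t t', nth_error ts m = Some t -> nth_error ts' m = Some t' ->
    Θ ⊢ ren n b p q t ≡ ren n b p q t' ∷ Tiny) ->
  (p <= x -> q <= length ts) ->
  Θ ⊢ ren n b p q (Var x ts) ≡ ren n b p q (Var x ts') ∷ A.
Proof.
  intros T L F H. apply Forall2_nth_error in F; auto.
  destruct (Nat.lt_ge_cases x p) as [Hx|Hx].
  - rewrite !ren_inner in * by auto. apply deq_keys; auto.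
    clear - F; induction F; cbn; auto.
  - destruct (list_split ts q) as (j & k & -> & Lk); auto.
    apply Forall2_app_inv_l in F as (j' & k' & Fj & Fk & ->).
    assert (length k = length k') by (eapply Forall2_length; eauto).
    rewrite ren_outer in T |- * by auto. rewrite ren_outer by lia.
    pose proof (var_keys _ _ _ T _ _ eq_refl) as K.
    assert (M : forall l l', Forall2 (fun t t' => Θ ⊢ ren n b p q t ≡ ren n b p q t' ∷ Tiny) l l' ->
      Forall2 (fun t t' => Θ ⊢ t ≡ t' ∷ Tiny) (map (ren n b p q) l) (map (ren n b p q) l'))
      by (induction 1; cbn; auto).
    apply deq_keys; auto. repeat apply Forall2_app; auto.
    destruct b; cbn [key] in *; constructor; auto. apply deq_keys; auto.
    apply K. rewrite in_app_iff; cbn; auto.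
Qed.

Ltac prefix L Γ :=
  match L with
  | Γ => constr:(@nil entry)
  | ?G ++ Γ => G
  | ?e :: ?L => let G := prefix L Γ in constr:(e :: G)
  end.

Ltac specialize_prefix Γ := repeat match goal with
  | H : forall Γ1 : list entry, ?L = Γ1 ++ Γ -> _ |- _ =>
      let G := prefix L Γ in specialize (H G eq_refl)
  end.

Ltac collect_scoped St Se := repeat match goal with
  | H : ?Γ ⊢ _ ∷ _ |- _ =>
      let S := fresh "S" in pose proof (S := St _ _ _ H); revert H
  | H : ?Γ ⊢ _ ≡ _ ∷ _ |- _ =>
      let S := fresh "S" in pose proof (S := Se _ _ _ _ H); revert H
  end; intros; scoped_inv.

Ltac commute S0 W1 W2 K1 Γ1 := repeat match goal with
  | H : subst _ 0 _ _ |- _ => apply (S0 (shape Γ1)) in H; [|repeat constructor; auto; fail..]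
  | H : weak 1 _ _ |- _ => apply (W1 (shape Γ1)) in H; [|auto; fail]
  | H : counit 1 [] 1 0 _ _ |- _ => apply (W2 (shape Γ1)) in H; [|auto; fail]
  | H : keyed 1 _ _ |- _ => apply (K1 (shape Γ1)) in H; [|auto; fail]
  end.

Ltac ren_rule := first
  [ solve [eapply ty_conv; eauto] | solve [eapply ty_univ; eauto] | solve [eapply ty_tiny; eauto]
  | solve [eapply ty_pi; eauto] | solve [eapply ty_lam; eauto] | solve [eapply ty_app; eauto]
  | solve [eapply ty_sig; eauto] | solve [eapply ty_pair; eauto] | solve [eapply ty_fst; eauto]
  | solve [eapply ty_snd; eauto] | solve [eapply ty_sum; eauto] | solve [eapply ty_inl; eauto]
  | solve [eapply ty_inr; eauto] | solve [eapply ty_id; eauto] | solve [eapply ty_refl; eauto]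
  | solve [eapply ty_sqrt; eauto] | solve [eapply ty_lock; eauto] | solve [eapply ty_ev; eauto]
  | solve [eapply deq_reflexive; eauto] | solve [eapply deq_symmetric; eauto]
  | solve [eapply deq_transitive; eauto] | solve [eapply deq_conv; eauto]
  | solve [eapply deq_pi_beta; eauto] | solve [eapply deq_pi_eta; eauto]
  | solve [eapply deq_fst_beta; eauto] | solve [eapply deq_snd_beta; eauto]
  | solve [eapply deq_sig_eta; eauto]
  | solve [eapply deq_sqrt_beta; eauto] | solve [eapply deq_sqrt_eta; eauto]
  | solve [eapply deq_pi; eauto] | solve [eapply deq_lam; eauto] | solve [eapply deq_app; eauto]
  | solve [eapply deq_sig; eauto] | solve [eapply deq_pair; eauto] | solve [eapply deq_fst; eauto]
  | solve [eapply deq_snd; eauto] | solve [eapply deq_sum; eauto] | solve [eapply deq_inl; eauto]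
  | solve [eapply deq_inr; eauto] | solve [eapply deq_id; eauto] | solve [eapply deq_refl; eauto]
  | solve [eapply deq_sqrt; eauto] | solve [eapply deq_lock; eauto] | solve [eapply deq_ev; eauto]].

(** The part [Γ0] to the left of the insertion is fixed and the part [Γ1] to its right varies, so
    binders only lengthen [Γ1]. Apart from variables, every rule is preserved because its counit,
    substitution and unit side conditions commute with [ren]. *)
Theorem ren_judgement n b Γ0 Γ' : wf (Γ' ++ Γ0) -> insertion n b Γ' ->
  (forall Γ, wf Γ -> forall Γ1, Γ = Γ1 ++ Γ0 -> wf (ren_ctx n b Γ1 ++ Γ' ++ Γ0)) /\
  (forall Γ a A, Γ ⊢ a ∷ A -> forall Γ1, Γ = Γ1 ++ Γ0 ->
    ren_ctx n b Γ1 ++ Γ' ++ Γ0 ⊢ ren_past n b Γ1 a ∷ ren_past n b Γ1 A) /\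
  (forall Γ a a' A, Γ ⊢ a ≡ a' ∷ A -> forall Γ1, Γ = Γ1 ++ Γ0 ->
    ren_ctx n b Γ1 ++ Γ' ++ Γ0 ⊢ ren_past n b Γ1 a ≡ ren_past n b Γ1 a' ∷ ren_past n b Γ1 A).
Proof.
  intros W I. pose proof (insertion_block _ _ _ I) as B.
  assert (S0 : forall s a c c', scoped (s ++ shape Γ0) a -> scoped (true :: s ++ shape Γ0) c ->
    subst a 0 c c' -> subst (ren n b (nv s) (nl s) a) 0 (ren n b (S (nv s)) (nl s) c)
      (ren n b (nv s) (nl s) c')).
  { intros; apply (subst_ren n b a 0 c c') with (s := []) (s2 := s) (s0 := shape Γ0); auto. }
  assert (S1 : forall s a c c', scoped (s ++ shape Γ0) a ->
    scoped (true :: true :: s ++ shape Γ0) c ->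
    subst a 1 c c' -> subst (ren n b (nv s) (nl s) a) 1 (ren n b (S (S (nv s))) (nl s) c)
      (ren n b (S (nv s)) (nl s) c')).
  { intros; apply (subst_ren n b a 1 c c') with (s := [true]) (s2 := s) (s0 := shape Γ0); auto. }
  assert (W1 : forall s a a', scoped (s ++ shape Γ0) a -> weak 1 a a' ->
    weak 1 (ren n b (nv s) (nl s) a) (ren n b (S (nv s)) (nl s) a')).
  { intros s a a' Sa C; apply (counit_ren_outer n b _ _ _ _ _ _ C [] [true] s (shape Γ0)); auto. }
  assert (W2 : forall s a a', scoped (true :: s ++ shape Γ0) a -> counit 1 [] 1 0 a a' ->
    counit 1 [] 1 0 (ren n b (S (nv s)) (nl s) a) (ren n b (S (S (nv s))) (nl s) a')).
  { intros s a a' Sa C; apply (counit_ren_outer n b _ _ _ _ _ _ C [true] [true] s (shape Γ0)); auto. }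
  assert (K1 : forall s a a', scoped (s ++ shape Γ0) a -> keyed 1 a a' ->
    keyed 1 (ren n b (nv s) (nl s) a) (ren n b (S (nv s)) (S (nl s)) a')).
  { intros s a a' Sa C.
    apply (counit_ren_outer n b _ _ _ _ _ _ C [] [true; false] s (shape Γ0)); auto.
    repeat constructor. }
  assert (U0 : forall s a, scoped (false :: true :: s ++ shape Γ0) a ->
    ren n b (nv s) (nl s) (unit_lock 0 0 a) =
    unit_lock 0 0 (ren n b (S (nv s)) (S (nl s)) a)).
  { intros; symmetry; apply (unit_lock_ren n b [] s (shape Γ0)); auto. }
  (* The intermediate types of the rules for case distinction and [J] occur in no typing premise;
     their scoping is derived from the counit or substitution that produces them. *)
  assert (C0 : forall s o c c1 c', scoped (true :: s ++ shape Γ0) c -> counit 1 [] 1 0 c c1 ->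
    subst (Op o [Var 0 []]) 0 c1 c' -> subst (Op o [Var 0 []]) 0
      (ren n b (S (S (nv s))) (nl s) c1) (ren n b (S (nv s)) (nl s) c')).
  { intros s o c c1 c' Sc C H. apply (S0 (true :: s)) in H; auto; [repeat constructor|].
    eapply (scoped_counit _ _ _ _ _ _ C [true] [true]); auto. }
  assert (J0 : forall s a c c0 q c', scoped (s ++ shape Γ0) a -> scoped (s ++ shape Γ0) q ->
    scoped (true :: true :: s ++ shape Γ0) c -> subst a 1 c c0 -> subst q 0 c0 c' ->
    subst (ren n b (nv s) (nl s) q) 0 (ren n b (S (nv s)) (nl s) c0)
      (ren n b (nv s) (nl s) c')).
  { intros s a c c0 q c' Sa Sq Sc H H'. apply S0; auto.
    eapply (scoped_subst _ _ _ _ H [true]); eauto. }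
  destruct judgement_scoped as (Sw & St & Se).
  apply judgement_ind.
  1: { intros Γ1 E; symmetry in E; apply app_eq_nil in E as [-> ->]; auto. }
  1: { intros Γ A i _ IHw _ IHA [|e Γ1] E; cbn in E; subst; auto.
       inversion E; subst. cbn; econstructor; eauto. }
  1: { intros Γ _ IHw [|e Γ1] E; cbn in E; subst; auto.
       inversion E; subst. cbn; econstructor; eauto. }
  all: intros; subst; collect_scoped St Se; specialize_prefix Γ0.
  all: try match goal with
    | |- _ ⊢ ren_past _ _ _ (Var _ _) ∷ _ =>
        apply ren_var_typed with (A := A) (Γa := Γ); eauto
    end.
  all: unfold ren_past in *; cbn [shape app] in *; rewrite ?shape_app in *; cbn in *.
  all: rewrite ?U0 by auto.
  all: try solve [commute S0 W1 W2 K1 Γ1; ren_rule].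
  all: try solve [repeat match goal with
    | C : counit 1 [] 1 0 ?c ?c1, H : subst (Op ?o _) 0 ?c1 ?c' |- _ =>
        apply (fun S => C0 (shape Γ1) o c c1 c' S C) in H; [|assumption]
    end; commute S0 W1 W2 K1 Γ1;
    first [eapply ty_case | eapply deq_inl_beta | eapply deq_inr_beta | eapply deq_case]; eauto].
  all: try solve [repeat match goal with
    | H : subst ?a 1 ?c ?c0, H' : subst ?q 0 ?c0 ?c' |- _ =>
        apply (fun S S' S2 => J0 (shape Γ1) a c c0 q c' S S' S2 H) in H';
          [|assumption|repeat constructor; assumption|assumption];
        apply (S1 (shape Γ1)) in H; [|assumption..]
    end; commute S0 W1 W2 K1 Γ1; first [eapply ty_J | eapply deq_J_beta | eapply deq_J];
    (* The typing of the motive, the weakenings and the identity proof are matched first, because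
       they determine the unknowns of the remaining premises. *)
    try match goal with |- EVar _ :: EVar _ :: _ ⊢ _ ∷ _ => eassumption end;
    try match goal with
      | |- weak _ _ _ => eassumption
      | |- _ ⊢ _ ∷ Id _ _ _ => eassumption
      | |- _ ⊢ _ ≡ _ ∷ Id _ _ _ => eassumption
      end; eassumption].
  - rewrite <- shape_app, <- H5. apply Forall_forall; intros t Ht. apply (St _ _ _ (H2 _ Ht)).
  - eapply ren_var_equal; eauto.
    intros Hx. match goal with S : scoped _ (Var x ts) |- _ => inversion S as [? ? ? L| | |]; subst end.
    rewrite L, arity_outer by auto; lia.
Qed.

Lemma judgement_wf :
  (forall Γ, wf Γ -> True) /\
  (forall Γ a A, Γ ⊢ a ∷ A -> wf Γ) /\
  (forall Γ a b A, Γ ⊢ a ≡ b ∷ A -> wf Γ).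
Proof.
  apply judgement_ind; intros; auto; repeat match goal with
  | H : wf (_ :: _) |- _ => inversion H; clear H; subst
  end; auto.
Qed.

Lemma typing_wf Γ a A : Γ ⊢ a ∷ A -> wf Γ.
Proof. apply judgement_wf. Qed.

Lemma typing_scoped Γ a A : Γ ⊢ a ∷ A -> scoped (shape Γ) a.
Proof. apply judgement_scoped. Qed.

Lemma type_scoped Γ a A : Γ ⊢ a ∷ A -> scoped (shape Γ) A.
Proof. apply judgement_scoped. Qed.

Lemma ren_typing n b Γ0 Γ' Γ1 a A : wf (Γ' ++ Γ0) -> insertion n b Γ' ->
  Γ1 ++ Γ0 ⊢ a ∷ A ->
  ren_ctx n b Γ1 ++ Γ' ++ Γ0 ⊢ ren_past n b Γ1 a ∷ ren_past n b Γ1 A.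
Proof. intros W I H. eapply (ren_judgement n b Γ0 Γ' W I); eauto. Qed.

Lemma ren_equal n b Γ0 Γ' Γ1 a a' A : wf (Γ' ++ Γ0) -> insertion n b Γ' ->
  Γ1 ++ Γ0 ⊢ a ≡ a' ∷ A ->
  ren_ctx n b Γ1 ++ Γ' ++ Γ0 ⊢ ren_past n b Γ1 a ≡ ren_past n b Γ1 a' ∷ ren_past n b Γ1 A.
Proof. intros W I H. eapply (ren_judgement n b Γ0 Γ' W I); eauto. Qed.

(* [a] over [Γ] weakened to [Γ, Γ'], for [Γ'] without locks, and [a[t/key_L]] over
   [Γ, Γ', t : T], for [Γ'] with the only lock [L]; [n] is the number of variables added. *)
Notation wk n := (ren n false 0 0).
Notation kw n := (ren n true 0 0).
Notation dn n a := (Ev (kw (S n) a)).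

(** * Composites of weakenings and keys *)

Lemma block_weak n : block n false (repeat true n).
Proof. repeat split; [..|discriminate]; induction n; cbn; auto. Qed.

Lemma ren_0 s a : scoped s a -> wk 0 a = a.
Proof.
  intros H.
  eapply (counit_functional 0 [] 0 0); [|apply (counit_id [] s a H)].
  apply (ren_counit 0 false [] [] s); auto. apply (block_weak 0).
Qed.

Lemma wk_wk n m s a : scoped s a -> wk n (wk m a) = wk (n + m) a.
Proof.
  intros H.
  apply (ren_ren_middle n false m false [] (repeat true n) [] (repeat true m) s);
    auto using block_weak; discriminate.
Qed.

(** A block is recorded only by its number of variables and its key, so the [m] variables to the
    left of the lock merge with those to its right. *)
Lemma kw_wk n m s a : scoped s a -> kw (S n) (wk m a) = kw (S n + m) a.
Proof.
  intros H.
  apply (ren_ren_middle (S n) true m false [] (repeat true (S n) ++ [false]) [] (repeat true m) s);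
    auto using block_weak, block_key; discriminate.
Qed.

Lemma weak_wk n m s a : scoped s a -> ren n false 1 0 (wk (S m) a) = wk (n + S m) a.
Proof.
  intros H.
  apply (ren_ren_middle n false (S m) false [] (repeat true n) [true] (repeat true m) s);
    auto using block_weak; try discriminate; apply (block_weak (S m)).
Qed.

Lemma weak_kw n m s a : scoped s a -> ren n false 1 0 (kw (S m) a) = kw (n + S m) a.
Proof.
  intros H.
  apply (ren_ren_middle n false (S m) true [] (repeat true n) [true] (repeat true m ++ [false]) s);
    auto using block_weak; try discriminate; apply (block_key m).
Qed.
Lemma ren_kw n b m s1 s2 s0 a : block n b s1 -> scoped (s2 ++ s0) a ->
  ren n b (S m + nv s2) (S (nl s2)) (kw (S m) a) = kw (S m) (ren n b (nv s2) (nl s2) a).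
Proof.
  intros B H.
  pose proof (ren_ren_outer n b (S m) true [] (repeat true (S m) ++ [false]) s2 s1 s0 a
    (block_key m) B H) as E.
  assert (N : forall t, nv ((repeat true (S m) ++ [false]) ++ t) = S m + nv t)
    by (intros; rewrite nv_app; destruct (block_key m) as (-> & _); auto).
  assert (L : forall t, nl ((repeat true (S m) ++ [false]) ++ t) = S (nl t))
    by (intros; rewrite nl_app; destruct (block_key m) as (_ & -> & _); auto).
  cbn [app] in E, N, L. rewrite N, L in E. exact E.
Qed.

Lemma ren_wk n b m s1 s2 s0 a : block n b s1 -> scoped (s2 ++ s0) a ->
  ren n b (m + nv s2) (nl s2) (wk m a) = wk m (ren n b (nv s2) (nl s2) a).
Proof.
  intros B H.
  pose proof (ren_ren_outer n b m false [] (repeat true m) s2 s1 s0 a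
    (block_weak m) B H) as E.
  cbn [app] in E. rewrite nv_app, nl_app in E.
  destruct (block_weak m) as (N & L & _). rewrite N, L in E. exact E.
Qed.

(** Read under the binder [t] of an [ev]: the key of the first lock is [i⟨t/M⟩], and eliminating [i]
    with [lock_M] leaves [t]. Hence [P[i/key_L]_↓] becomes [P_↓]. The two renamings are exchanged
    first, so that the triangle identity applies. *)
Lemma unit_lock_kw_kw n s a : scoped s a ->
  unit_lock 1 0 (kw 1 (kw (S n) a)) = kw (S n) a.
Proof.
  intros H.
  pose proof (ren_kw (S n) true 0 _ [] s a (block_key n) H) as E.
  cbn [nv nl Nat.add] in E. rewrite <- E.
  change (unit_lock (nv [true]) (nl [true]) (ren (S n) true (nv [true]) (S (nl [true])) (kw 1 a)) =
    kw (S n) a).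
  rewrite (unit_lock_ren_key n [true] s).
  - cbn [nv nl]. rewrite (weak_kw _ _ s) by auto. f_equal; lia.
  - apply (scoped_ren 1 true [] [true; false] s a (block_key 0) H).
Qed.

Lemma unit_lock_kw_wk s a : scoped s a -> unit_lock 1 0 (kw 1 (wk 1 a)) = wk 1 a.
Proof. intros H. rewrite (kw_wk _ _ s) by auto. exact (unit_lock_key [] s a H). Qed.

(** Under the binder of an [ev] the substituted variable has index 1: it is crossed by the passage
    but is not the key, so it does not occur. *)
Lemma subst_kw n s c a : scoped s c -> subst a 1 (kw (S (S n)) c) (kw (S n) c).
Proof.
  intros H. replace (kw (S (S n)) c) with (ren 1 false 1 0 (kw (S n) c)).
  - apply (subst_weak a [true] (repeat true n ++ false :: s)).
    pose proof (scoped_ren (S n) true [] _ s c (block_key n) H) as S.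
    cbn in S. now rewrite <- app_assoc in S.
  - now rewrite (weak_kw _ _ s).
Qed.

Lemma subst_wk n s c a : scoped s c -> subst a 0 (wk (S n) c) (wk n c).
Proof.
  intros H; pose proof (wk_wk 1 n s c H) as E; cbn [Nat.add] in E; rewrite <- E.
  apply (subst_weak a [] (repeat true n ++ s)).
  apply (scoped_ren n false [] _ s c (block_weak n) H).
Qed.

Lemma weak_spec n s a : scoped s a -> weak n a (wk n a).
Proof. intros H; apply (ren_counit n false [] _ s a (block_weak n) H). Qed.

Lemma keyed_spec n s a : scoped s a -> keyed (S n) a (kw (S n) a).
Proof. intros H; apply (ren_counit (S n) true [] _ s a (block_key n) H). Qed.

Lemma unit_lock_ren_lock n s a : scoped (false :: s) a ->
  unit_lock 0 0 (ren (S n) true 0 1 a) = wk n a.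
Proof. intros H; exact (unit_lock_ren_key n [] s a H). Qed.

(** * The induction principle *)

(** The boolean selects the summand, [true] for the left one, so that both branches are treated by
    one proof. *)
Definition pick {X} (d : bool) (a b : X) : X := if d then a else b.

Definition inj (d : bool) : op := pick d OInl OInr.

Definition family (Γ : ctx) (i j k : nat) (A B P : tm) : Prop :=
  Γ ⊢ A ∷ Univ i /\ Γ ⊢ B ∷ Univ j /\
  Γ ⊢ P ∷ Sqrt (Pi (Pi Tiny (Sum (kw 1 A) (kw 1 B))) (Univ k)).

Definition partial_type (d : bool) (A B P : tm) : tm :=
  Sqrt (Pi (Pi Tiny (kw 1 (pick d A B)))
    (App (dn 1 P) (Lam (Op (inj d) [App (Var 1 []) (Var 0 [])])))).

Definition total_type (A B P : tm) : tm :=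
  Sqrt (Pi (Pi Tiny (Sum (kw 1 A) (kw 1 B))) (App (dn 1 P) (Var 0 []))).

(* [lock_M. g_↓(λ t. a⟨t/M⟩)], over [Γ, a], for [g] over [Γ]. *)
Definition branch (g : tm) : tm :=
  Lock (App (dn 0 (wk 1 g)) (Lam (Var 1 [Var 0 []]))).

(* [λ f. ev(i. case (f i) ...)], over [Γ, lock_L], for [g] and [h] over [Γ]. *)
Definition total (g h : tm) : tm :=
  Lam (Ev (Case (App (Var 1 []) (Var 0 [])) (branch (kw 2 g)) (branch (kw 2 h)))).

Lemma insertion_weak Γ : nlocks Γ = 0 -> insertion (nvars Γ) false Γ.
Proof. repeat split; auto; discriminate. Qed.

Lemma insertion_key Γ : nlocks Γ = 0 ->
  insertion (S (nvars Γ)) true (EVar Tiny :: Γ ++ [ELock]).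
Proof.
  rewrite nlocks_shape, nvars_shape; intros L. unfold insertion.
  rewrite nvars_shape, nlocks_shape; cbn; rewrite shape_app, nv_app, nl_app, L; cbn.
  rewrite Nat.add_0_r; eauto.
Qed.

Lemma pick_ren n b p q d A B : ren n b p q (pick d A B) = pick d (ren n b p q A) (ren n b p q B).
Proof. now destruct d. Qed.

Lemma pick_typed Γ d A B i j : Γ ⊢ A ∷ Univ i -> Γ ⊢ B ∷ Univ j ->
  Γ ⊢ pick d A B ∷ Univ (pick d i j).
Proof. now destruct d. Qed.

Lemma inj_typed Γ d A B i j a : Γ ⊢ A ∷ Univ i -> Γ ⊢ B ∷ Univ j ->
  Γ ⊢ a ∷ pick d A B -> Γ ⊢ Op (inj d) [a] ∷ Sum A B.
Proof. intros; destruct d; [eapply ty_inl|eapply ty_inr]; eauto. Qed.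

Lemma inj_equal Γ d A B i j a a' : Γ ⊢ A ∷ Univ i -> Γ ⊢ B ∷ Univ j ->
  Γ ⊢ a ≡ a' ∷ pick d A B -> Γ ⊢ Op (inj d) [a] ≡ Op (inj d) [a'] ∷ Sum A B.
Proof. intros; destruct d; [eapply deq_inl|eapply deq_inr]; eauto. Qed.

(** * Typing behind a lock *)

Lemma typing_wk Γ Δ a A : wf (Δ ++ Γ) -> nlocks Δ = 0 -> Γ ⊢ a ∷ A ->
  Δ ++ Γ ⊢ wk (nvars Δ) a ∷ wk (nvars Δ) A.
Proof. intros W L H. apply (ren_typing _ false Γ Δ []); auto using insertion_weak. Qed.

Lemma wf_tiny Γ : wf Γ -> wf (EVar Tiny :: Γ).
Proof. intros W. eapply wf_var; auto. now apply ty_tiny. Qed.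

Lemma typing_kw Γ Δ a A : wf (Δ ++ ELock :: Γ) -> nlocks Δ = 0 -> Γ ⊢ a ∷ A ->
  EVar Tiny :: Δ ++ ELock :: Γ ⊢ kw (S (nvars Δ)) a ∷ kw (S (nvars Δ)) A.
Proof.
  intros W L H.
  pose proof (ren_typing (S (nvars Δ)) true Γ (EVar Tiny :: Δ ++ [ELock]) [] a A) as R.
  cbn [app] in R; rewrite <- app_assoc in R. apply R; auto using insertion_key, wf_tiny.
Qed.

Lemma equal_kw Γ Δ a a' A : wf (Δ ++ ELock :: Γ) -> nlocks Δ = 0 -> Γ ⊢ a ≡ a' ∷ A ->
  EVar Tiny :: Δ ++ ELock :: Γ ⊢ kw (S (nvars Δ)) a ≡ kw (S (nvars Δ)) a' ∷ kw (S (nvars Δ)) A.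
Proof.
  intros W L H.
  pose proof (ren_equal (S (nvars Δ)) true Γ (EVar Tiny :: Δ ++ [ELock]) [] a a' A) as R.
  cbn [app] in R; rewrite <- app_assoc in R. apply R; auto using insertion_key, wf_tiny.
Qed.

(** The rule for [ev] yields the unit applied to the keyed [A]; by the triangle identity this is [A]
    weakened. *)
Lemma down_typed Γ Δ a A : wf (Δ ++ ELock :: Γ) -> nlocks Δ = 0 -> Γ ⊢ a ∷ Sqrt A ->
  Δ ++ ELock :: Γ ⊢ dn (nvars Δ) a ∷ wk (nvars Δ) A.
Proof.
  intros W L H. pose proof (type_scoped _ _ _ H) as S. scoped_inv.
  rewrite <- (unit_lock_ren_lock (nvars Δ) (shape Γ) A) by auto.
  apply ty_ev. apply (typing_kw _ _ _ _ W L H).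
Qed.

Lemma down_equal Γ Δ a a' A : wf (Δ ++ ELock :: Γ) -> nlocks Δ = 0 -> Γ ⊢ a ≡ a' ∷ Sqrt A ->
  Δ ++ ELock :: Γ ⊢ dn (nvars Δ) a ≡ dn (nvars Δ) a' ∷ wk (nvars Δ) A.
Proof.
  intros W L H. destruct (proj2 (proj2 judgement_scoped) _ _ _ _ H) as (_ & _ & S). scoped_inv.
  rewrite <- (unit_lock_ren_lock (nvars Δ) (shape Γ) A) by auto.
  apply deq_ev. apply (equal_kw _ _ _ _ _ W L H).
Qed.

(** The β-rule of [√] produces a unit of a keyed term, which the triangle identity reduces to the
    term itself, weakened by no variables. *)
Lemma down_lock Γ a A : ELock :: Γ ⊢ a ∷ A -> ELock :: Γ ⊢ dn 0 (Lock a) ≡ a ∷ A.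
Proof.
  intros H. pose proof (typing_scoped _ _ _ H) as Sa; pose proof (type_scoped _ _ _ H) as SA.
  pose proof (typing_wf _ _ _ H) as W.
  assert (E : forall c, scoped (false :: shape Γ) c -> unit_lock 0 0 (ren 1 true 0 1 c) = c).
  { intros c Sc. rewrite (unit_lock_ren_lock 0 (shape Γ)) by auto. eapply ren_0; eauto. }
  rewrite <- (E a) at 2 by auto. rewrite <- (E A) by auto.
  apply deq_sqrt_beta.
  apply (ren_typing 1 true Γ [EVar Tiny; ELock] [ELock]); auto.
  - now apply wf_tiny.
  - now apply (insertion_key []).
Qed.

Lemma family_ren Γ i j k A B P n b Δ : family Γ i j k A B P -> wf (Δ ++ Γ) -> insertion n b Δ ->
  family (Δ ++ Γ) i j k (ren n b 0 0 A) (ren n b 0 0 B) (ren n b 0 0 P).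
Proof.
  intros (HA & HB & HP) W I.
  pose proof (typing_scoped _ _ _ HA); pose proof (typing_scoped _ _ _ HB).
  repeat split.
  - apply (ren_typing n b Γ Δ [] _ _ W I HA).
  - apply (ren_typing n b Γ Δ [] _ _ W I HB).
  - pose proof (ren_typing n b Γ Δ [] _ _ W I HP) as R.
    cbn -[ren] in R. unfold ren_past in R. cbn [ren map nv nl shape] in R.
    pose proof (ren_kw n b 0 _ [] _ A (insertion_block _ _ _ I) H) as EA.
    pose proof (ren_kw n b 0 _ [] _ B (insertion_block _ _ _ I) H0) as EB.
    cbn [nv nl Nat.add] in EA, EB. rewrite EA, EB in R. exact R.
Qed.
Lemma partial_type_ren n b s s0 s1 d A B P : block n b s1 ->
  scoped (s ++ s0) A -> scoped (s ++ s0) B -> scoped (s ++ s0) P ->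
  ren n b (nv s) (nl s) (partial_type d A B P) =
  partial_type d (ren n b (nv s) (nl s) A) (ren n b (nv s) (nl s) B) (ren n b (nv s) (nl s) P).
Proof.
  intros Bl SA SB SP. unfold partial_type. cbn -[ren pick inj]. cbn [ren map].
  pose proof (ren_kw n b 0 _ s _ A Bl SA) as EA. pose proof (ren_kw n b 0 _ s _ B Bl SB) as EB.
  pose proof (ren_kw n b 1 _ s _ P Bl SP) as EP. cbn [Nat.add] in EA, EB, EP.
  rewrite EP. destruct d; cbn [pick]; rewrite ?EA, ?EB; reflexivity.
Qed.

Lemma total_type_ren n b s s0 s1 A B P : block n b s1 ->
  scoped (s ++ s0) A -> scoped (s ++ s0) B -> scoped (s ++ s0) P ->
  ren n b (nv s) (nl s) (total_type A B P) =
  total_type (ren n b (nv s) (nl s) A) (ren n b (nv s) (nl s) B) (ren n b (nv s) (nl s) P).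
Proof.
  intros Bl SA SB SP. unfold total_type. cbn [ren map].
  pose proof (ren_kw n b 0 _ s _ A Bl SA) as EA. pose proof (ren_kw n b 0 _ s _ B Bl SB) as EB.
  pose proof (ren_kw n b 1 _ s _ P Bl SP) as EP. cbn [Nat.add] in EA, EB, EP.
  now rewrite EP, EA, EB.
Qed.

Lemma var_typed Γ Δ A : wf (Δ ++ EVar A :: Γ) -> nlocks Δ = 0 ->
  Δ ++ EVar A :: Γ ⊢ Var (nvars Δ) [] ∷ wk (S (nvars Δ)) A.
Proof.
  intros W L. eapply ty_var; auto.
  - intros t [].
  - apply (weak_spec _ (shape Γ)). exact (proj1 judgement_scoped _ W _ _ _ eq_refl).
Qed.

Lemma eta Γ A B f : Γ ⊢ f ∷ Pi A B -> Γ ⊢ f ≡ Lam (App (wk 1 f) (Var 0 [])) ∷ Pi A B.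
Proof.
  intros H. eapply deq_pi_eta; eauto. eapply weak_spec, typing_scoped; eauto.
Qed.

(** After weakening by [t], the codomain is keyed by its own bound variable; application replaces
    that one by [t], as in [subst_key]. *)
Lemma apply_typed Γ Δ X l i : Γ ⊢ X ∷ Univ i -> nlocks Δ = 0 ->
  Δ ++ ELock :: Γ ⊢ l ∷ Pi Tiny (kw (S (nvars Δ)) X) ->
  EVar Tiny :: Δ ++ ELock :: Γ ⊢ App (wk 1 l) (Var 0 []) ∷ kw (S (nvars Δ)) X.
Proof.
  intros HX L Hl. pose proof (wf_tiny _ (typing_wf _ _ _ Hl)) as W.
  pose proof (typing_scoped _ _ _ HX) as SX.
  pose proof (typing_wk _ [EVar Tiny] _ _ W eq_refl Hl) as R.
  cbn -[ren] in R. cbn [ren map] in R. rewrite (weak_kw _ _ (shape Γ)) in R by auto.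
  eapply ty_app; [exact R|exact (var_typed _ [] _ W eq_refl)|].
  exact (subst_key _ [] (shape Γ) _ SX).
Qed.

Lemma wf_arrow Γ Δ X i : Γ ⊢ X ∷ Univ i -> wf (Δ ++ ELock :: Γ) -> nlocks Δ = 0 ->
  Δ ++ ELock :: Γ ⊢ Pi Tiny (kw (S (nvars Δ)) X) ∷ Univ i.
Proof.
  intros HX W L. apply (ty_pi _ _ _ 0 i); [now apply ty_tiny|].
  exact (typing_kw _ _ _ _ W L HX).
Qed.

Lemma family_pick Γ i j k A B P d : family Γ i j k A B P ->
  Γ ⊢ pick d A B ∷ Univ (pick d i j).
Proof. intros (HA & HB & _). now apply pick_typed. Qed.

Lemma family_sum Γ i j k A B P : family Γ i j k A B P -> Γ ⊢ Sum A B ∷ Univ (Nat.max i j).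
Proof. intros (HA & HB & _). now apply ty_sum. Qed.

Lemma inj_compose_typed Γ Δ i j k A B P d l : family Γ i j k A B P -> nlocks Δ = 0 ->
  Δ ++ ELock :: Γ ⊢ l ∷ Pi Tiny (kw (S (nvars Δ)) (pick d A B)) ->
  Δ ++ ELock :: Γ ⊢ Lam (Op (inj d) [App (wk 1 l) (Var 0 [])]) ∷
    Pi Tiny (kw (S (nvars Δ)) (Sum A B)).
Proof.
  intros F L Hl. pose proof (typing_wf _ _ _ Hl) as W.
  eapply ty_lam; [now apply ty_tiny|].
  pose proof F as (HA & HB & _). cbn [ren map]. eapply inj_typed.
  - exact (typing_kw _ _ _ _ W L HA).
  - exact (typing_kw _ _ _ _ W L HB).
  - rewrite <- pick_ren. eapply apply_typed; eauto. eapply family_pick; eauto.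
Qed.

Lemma predicate_typed Γ Δ i j k A B P : family Γ i j k A B P ->
  wf (Δ ++ ELock :: Γ) -> nlocks Δ = 0 ->
  Δ ++ ELock :: Γ ⊢ dn (nvars Δ) P ∷ Pi (Pi Tiny (kw (S (nvars Δ)) (Sum A B))) (Univ k).
Proof.
  intros (HA & HB & HP) W L.
  pose proof (down_typed _ _ _ _ W L HP) as R. cbn [ren map] in R |- *.
  pose proof (typing_scoped _ _ _ HA); pose proof (typing_scoped _ _ _ HB).
  rewrite !(weak_kw _ _ (shape Γ)), Nat.add_1_r in R by auto. exact R.
Qed.

Lemma predicate_app_typed Γ Δ i j k A B P f : family Γ i j k A B P -> nlocks Δ = 0 ->
  Δ ++ ELock :: Γ ⊢ f ∷ Pi Tiny (kw (S (nvars Δ)) (Sum A B)) ->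
  Δ ++ ELock :: Γ ⊢ App (dn (nvars Δ) P) f ∷ Univ k.
Proof.
  intros F L Hf. eapply ty_app; [|exact Hf|apply subst_op; constructor].
  eapply predicate_typed; eauto using typing_wf.
Qed.

Lemma predicate_app_equal Γ Δ i j k A B P f f' : family Γ i j k A B P -> nlocks Δ = 0 ->
  wf (Δ ++ ELock :: Γ) ->
  Δ ++ ELock :: Γ ⊢ f ≡ f' ∷ Pi Tiny (kw (S (nvars Δ)) (Sum A B)) ->
  Δ ++ ELock :: Γ ⊢ App (dn (nvars Δ) P) f ≡ App (dn (nvars Δ) P) f' ∷ Univ k.
Proof.
  intros F L W Hf. eapply deq_app; [|exact Hf|apply subst_op; constructor].
  apply deq_reflexive. eapply predicate_typed; eauto using typing_wf.
Qed.

Lemma partial_codomain_typed Γ i j k A B P d : family Γ i j k A B P ->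
  EVar (Pi Tiny (kw 1 (pick d A B))) :: ELock :: Γ ⊢
    App (dn 1 P) (Lam (Op (inj d) [App (Var 1 []) (Var 0 [])])) ∷ Univ k.
Proof.
  intros F. pose proof (family_pick _ _ _ _ _ _ _ d F) as HX.
  assert (W : wf (ELock :: Γ)) by (apply wf_lock; eauto using typing_wf).
  pose proof (wf_arrow _ [] _ _ HX W eq_refl) as HY.
  assert (W' : wf (EVar (Pi Tiny (kw 1 (pick d A B))) :: ELock :: Γ)) by (eapply wf_var; eauto).
  apply (predicate_app_typed Γ [EVar _] i j k A B); auto.
  apply (inj_compose_typed Γ [EVar _] i j k A B P d (Var 0 [])); auto.
  pose proof (var_typed _ [] _ W' eq_refl) as R. cbn [ren map nvars filter length app] in R |- *.
  rewrite (weak_kw _ _ (shape Γ)) in R; eauto using typing_scoped.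
Qed.

Lemma partial_type_typed Γ i j k A B P d : family Γ i j k A B P ->
  Γ ⊢ partial_type d A B P ∷ Univ (Nat.max (pick d i j) k).
Proof.
  intros F. apply ty_sqrt, ty_pi; [|now apply (partial_codomain_typed _ i j)].
  pose proof (family_pick _ _ _ _ _ _ _ d F) as HX.
  apply (wf_arrow _ [] _ _ HX); auto. apply wf_lock; eauto using typing_wf.
Qed.

Lemma subst_partial_codomain s d P l : scoped s P -> scoped (false :: s) l ->
  subst l 0 (App (dn 1 P) (Lam (Op (inj d) [App (Var 1 []) (Var 0 [])])))
    (App (dn 0 P) (Lam (Op (inj d) [App (wk 1 l) (Var 0 [])]))).
Proof.
  intros SP Sl. repeat first [apply (subst_kw 0 s); assumption
    |apply Forall2_cons|apply Forall2_nil|apply subst_op|apply subst_abs].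
  - eapply subst_this; [constructor|]. exact (weak_spec 1 _ _ Sl).
  - apply subst_inner; auto.
Qed.

Lemma partial_app_typed Γ i j k A B P d g l : family Γ i j k A B P ->
  Γ ⊢ g ∷ partial_type d A B P -> ELock :: Γ ⊢ l ∷ Pi Tiny (kw 1 (pick d A B)) ->
  ELock :: Γ ⊢ App (dn 0 g) l ∷
    App (dn 0 P) (Lam (Op (inj d) [App (wk 1 l) (Var 0 [])])).
Proof.
  intros F Hg Hl. pose proof (typing_wf _ _ _ Hl) as W.
  pose proof (down_typed Γ [] _ _ W eq_refl Hg) as R.
  pose proof (type_scoped _ _ _ Hg) as Sg. unfold partial_type in Sg. inversion Sg; subst.
  inversion H1; subst. inversion H2; subst.
  cbn [nvars filter length app] in R.
  rewrite (ren_0 (false :: shape Γ)) in R by auto.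
  eapply ty_app; eauto. destruct F as (_ & _ & HP).
  eapply subst_partial_codomain; eauto using typing_scoped. exact (typing_scoped _ _ _ Hl).
Qed.

Lemma partial_app_equal Γ i j k A B P d g l l' : family Γ i j k A B P ->
  Γ ⊢ g ∷ partial_type d A B P -> ELock :: Γ ⊢ l ∷ Pi Tiny (kw 1 (pick d A B)) ->
  ELock :: Γ ⊢ l ≡ l' ∷ Pi Tiny (kw 1 (pick d A B)) ->
  ELock :: Γ ⊢ App (dn 0 g) l ≡ App (dn 0 g) l' ∷
    App (dn 0 P) (Lam (Op (inj d) [App (wk 1 l) (Var 0 [])])).
Proof.
  intros F Hg Hl E. pose proof (typing_wf _ _ _ Hl) as W.
  pose proof (down_typed Γ [] _ _ W eq_refl Hg) as R.
  pose proof (type_scoped _ _ _ Hg) as Sg. unfold partial_type in Sg. inversion Sg; subst.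
  inversion H1; subst. inversion H2; subst.
  cbn [nvars filter length app] in R.
  rewrite (ren_0 (false :: shape Γ)) in R by auto.
  eapply deq_app; eauto using deq_reflexive. destruct F as (_ & _ & HP).
  eapply subst_partial_codomain; eauto using typing_scoped. exact (typing_scoped _ _ _ Hl).
Qed.

(* [√_M(P_↓(λ t. s⟨t/M⟩))], over [Γ]. *)
Definition motive (P s : tm) : tm := Sqrt (App (dn 0 P) (Lam (kw 1 s))).

(** * Constant functions and the case distinction *)

Lemma constant_typed Γ Δ X a i : Γ ⊢ X ∷ Univ i -> wf (Δ ++ ELock :: Γ) -> nlocks Δ = 0 ->
  Γ ⊢ a ∷ X -> Δ ++ ELock :: Γ ⊢ Lam (kw (S (nvars Δ)) a) ∷ Pi Tiny (kw (S (nvars Δ)) X).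
Proof.
  intros HX W L Ha. eapply ty_lam; [now apply ty_tiny|]. exact (typing_kw _ _ _ _ W L Ha).
Qed.

Lemma constant_equal Γ Δ X a a' i : Γ ⊢ X ∷ Univ i -> wf (Δ ++ ELock :: Γ) -> nlocks Δ = 0 ->
  Γ ⊢ a ≡ a' ∷ X ->
  Δ ++ ELock :: Γ ⊢ Lam (kw (S (nvars Δ)) a) ≡ Lam (kw (S (nvars Δ)) a') ∷
    Pi Tiny (kw (S (nvars Δ)) X).
Proof.
  intros HX W L Ha. eapply deq_lam; [now apply ty_tiny|]. exact (equal_kw _ _ _ _ _ W L Ha).
Qed.

Lemma constant_beta Γ X a : Γ ⊢ a ∷ X ->
  EVar Tiny :: ELock :: Γ ⊢ App (wk 1 (Lam (kw 1 a))) (Var 0 []) ≡ kw 1 a ∷ kw 1 X.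
Proof.
  intros Ha. pose proof (typing_scoped _ _ _ Ha) as Sa; pose proof (type_scoped _ _ _ Ha) as SX.
  assert (W : wf (EVar Tiny :: ELock :: Γ)) by (apply wf_tiny, wf_lock; eauto using typing_wf).
  cbn [ren map]. rewrite (weak_kw _ _ (shape Γ)) by auto. cbn [Nat.add].
  eapply deq_pi_beta.
  - now apply (ty_tiny).
  - exact (typing_kw Γ [EVar Tiny] _ _ W eq_refl Ha).
  - exact (var_typed _ [] _ W eq_refl).
  - exact (subst_key 0 [] _ _ Sa).
  - exact (subst_key 0 [] _ _ SX).
Qed.

(** The hypothesis [g] speaks of [λ t. inj ((λ t. a⟨t/M⟩) t)], while the motive at [inj a] has
    [λ t. (inj a)⟨t/M⟩]; they differ by a β-step under the binder. *)
Lemma partial_constant_typed Γ i j k A B P d g a : family Γ i j k A B P ->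
  Γ ⊢ g ∷ partial_type d A B P -> Γ ⊢ a ∷ pick d A B ->
  ELock :: Γ ⊢ App (dn 0 g) (Lam (kw 1 a)) ∷ App (dn 0 P) (Lam (kw 1 (Op (inj d) [a]))).
Proof.
  intros F Hg Ha. assert (W : wf (ELock :: Γ)) by (apply wf_lock; eauto using typing_wf).
  pose proof (family_pick _ _ _ _ _ _ _ d F) as HX. pose proof F as (HA & HB & _).
  pose proof (constant_typed _ [] _ _ _ HX W eq_refl Ha) as Hl.
  eapply ty_conv; [exact (partial_app_typed _ _ _ _ _ _ _ _ _ _ F Hg Hl)|].
  apply (predicate_app_equal Γ [] i j k A B); auto.
  eapply deq_lam; [now apply ty_tiny|]. cbn [ren map]. eapply inj_equal.
  - exact (typing_kw Γ [] _ _ W eq_refl HA).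
  - exact (typing_kw Γ [] _ _ W eq_refl HB).
  - rewrite <- pick_ren. exact (constant_beta _ _ _ Ha).
Qed.

Lemma motive_typed Γ i j k A B P s : family Γ i j k A B P -> Γ ⊢ s ∷ Sum A B ->
  Γ ⊢ motive P s ∷ Univ k.
Proof.
  intros F Hs. apply ty_sqrt. apply (predicate_app_typed Γ [] i j k A B); auto.
  eapply (constant_typed Γ []); eauto using family_sum, wf_lock, typing_wf.
Qed.

Lemma motive_equal Γ i j k A B P s s' : family Γ i j k A B P -> Γ ⊢ s ≡ s' ∷ Sum A B ->
  Γ ⊢ motive P s ≡ motive P s' ∷ Univ k.
Proof.
  intros F Hs. assert (W : wf (ELock :: Γ)) by (destruct F as (HA & _); eauto using wf_lock, typing_wf).
  apply deq_sqrt. apply (predicate_app_equal Γ [] i j k A B); auto.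
  eapply (constant_equal Γ []); eauto using family_sum.
Qed.

(** Used for the branches and for the motive, which have the same shape under the lock. Substituting
    into [x⟨t/M⟩] applies the counit to [a], giving [a⟨t/M⟩]. *)
Lemma subst_constant S g a : scoped S g -> scoped S a ->
  subst a 0 (LAbs (App (dn 0 (wk 1 g)) (Lam (Var 1 [Var 0 []]))))
    (LAbs (App (dn 0 g) (Lam (kw 1 a)))).
Proof.
  intros Sg Sa. rewrite (kw_wk _ _ S) by auto. cbn [Nat.add].
  repeat first [apply (subst_kw 0 S); assumption
    |apply Forall2_cons|apply Forall2_nil|apply subst_op|apply subst_abs|apply subst_labs].
  eapply subst_this; [|exact (keyed_spec 0 _ _ Sa)].
  repeat constructor.
Qed.

Lemma family_weak Γ i j k A B P X u : family Γ i j k A B P -> Γ ⊢ X ∷ Univ u ->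
  family (EVar X :: Γ) i j k (wk 1 A) (wk 1 B) (wk 1 P).
Proof.
  intros F HX. apply (family_ren _ _ _ _ _ _ _ 1 false [EVar X] F).
  - eapply wf_var; eauto using typing_wf.
  - apply (insertion_weak [EVar X]); auto.
Qed.

Lemma partial_type_weak n S d A B P : scoped S A -> scoped S B -> scoped S P ->
  wk n (partial_type d A B P) = partial_type d (wk n A) (wk n B) (wk n P).
Proof. apply (partial_type_ren n false [] S _ d A B P (block_weak n)). Qed.

Lemma branch_typed Γ i j k A B P d g : family Γ i j k A B P ->
  Γ ⊢ g ∷ partial_type d A B P ->
  EVar (pick d A B) :: Γ ⊢ branch g ∷ motive (wk 1 P) (Op (inj d) [Var 0 []]).
Proof.
  intros F Hg. pose proof (family_pick _ _ _ _ _ _ _ d F) as HX.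
  assert (W : wf (EVar (pick d A B) :: Γ)) by (eapply wf_var; eauto using typing_wf).
  pose proof F as (HA & HB & HP). apply ty_lock.
  pose proof (typing_wk _ [_] _ _ W eq_refl Hg) as R. cbn [nvars filter length app] in R.
  rewrite (partial_type_weak _ (shape Γ)) in R by eauto using typing_scoped.
  apply (partial_constant_typed _ _ _ _ _ _ _ _ _ (Var 0 []) (family_weak _ _ _ _ _ _ _ _ _ F HX) R).
  rewrite <- pick_ren. exact (var_typed _ [] _ W eq_refl).
Qed.

Lemma case_premises Γ i j k A B P : family Γ i j k A B P ->
  exists C C1, EVar (Sum A B) :: Γ ⊢ C ∷ Univ k /\ counit 1 [] 1 0 C C1 /\
    (forall d, subst (Op (inj d) [Var 0 []]) 0 C1 (motive (wk 1 P) (Op (inj d) [Var 0 []]))) /\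
    (forall s, Γ ⊢ s ∷ Sum A B -> subst s 0 C (motive P s)).
Proof.
  intros F. pose proof F as (HA & HB & HP).
  pose proof (family_weak _ _ _ _ _ _ _ _ _ F (family_sum _ _ _ _ _ _ _ F)) as F'.
  assert (W : wf (EVar (Sum A B) :: Γ)) by (destruct F'; eauto using typing_wf).
  pose proof (typing_scoped _ _ _ HP) as SP.
  assert (HC : EVar (Sum A B) :: Γ ⊢ motive (wk 1 P) (Var 0 []) ∷ Univ k).
  { eapply motive_typed; eauto. exact (var_typed _ [] _ W eq_refl). }
  exists (motive (wk 1 P) (Var 0 [])), (motive (wk 1 (wk 1 P)) (Var 0 [])).
  split; [exact HC|split; [|split]].
  - pose proof (ren_counit 1 false [true] [true] (shape Γ) _ (block_weak 1)
      (typing_scoped _ _ _ HC)) as R. cbn [nv nl key] in R.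
    replace (motive (wk 1 (wk 1 P)) (Var 0 [])) with (ren 1 false 1 0 (motive (wk 1 P) (Var 0 [])));
      auto.
    unfold motive. cbn [ren map]. do 6 f_equal.
    pose proof (ren_kw 1 false 0 _ [true] (shape Γ) (wk 1 P) (block_weak 1)
      (scoped_ren 1 false [] [true] _ _ (block_weak 1) SP)) as E.
    cbn [nv nl Nat.add] in E. rewrite E.
    rewrite (weak_wk _ _ (shape Γ)), (wk_wk _ _ (shape Γ)) by auto. reflexivity.
  - intros d. apply subst_op. constructor; auto.
    apply (subst_constant (true :: shape Γ)).
    + exact (scoped_ren 1 false [] [true] _ _ (block_weak 1) SP).
    + repeat constructor.
  - intros s Hs. apply subst_op. constructor; auto.
    eapply subst_constant; eauto using typing_scoped.
Qed.

Lemma case_typed Γ i j k A B P g h s : family Γ i j k A B P ->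
  Γ ⊢ g ∷ partial_type true A B P -> Γ ⊢ h ∷ partial_type false A B P ->
  Γ ⊢ s ∷ Sum A B -> Γ ⊢ Case s (branch g) (branch h) ∷ motive P s.
Proof.
  intros F Hg Hh Hs. destruct (case_premises _ _ _ _ _ _ _ F) as (C & C1 & HC & E & Si & Ss).
  eapply ty_case with (Cl := motive (wk 1 P) (Op (inj true) [Var 0 []]))
    (Cr := motive (wk 1 P) (Op (inj false) [Var 0 []])).
  - exact HC.
  - exact E.
  - exact (Si true).
  - exact (branch_typed _ _ _ _ _ _ _ true _ F Hg).
  - exact (Si false).
  - exact (branch_typed _ _ _ _ _ _ _ false _ F Hh).
  - exact Hs.
  - exact (Ss _ Hs).
Qed.

(** The scrutinee is only assumed equal to an injection: it will be [(λ t. inj (l t)) i], which has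
    to be reduced before the branch can be selected. *)
Lemma case_beta Γ i j k A B P g h s d a : family Γ i j k A B P ->
  Γ ⊢ g ∷ partial_type true A B P -> Γ ⊢ h ∷ partial_type false A B P ->
  Γ ⊢ s ∷ Sum A B -> Γ ⊢ a ∷ pick d A B -> Γ ⊢ s ≡ Op (inj d) [a] ∷ Sum A B ->
  Γ ⊢ Case s (branch g) (branch h) ≡ Lock (App (dn 0 (pick d g h)) (Lam (kw 1 a))) ∷ motive P s.
Proof.
  intros F Hg Hh Hs Ha E. pose proof F as (HA & HB & _).
  destruct (case_premises _ _ _ _ _ _ _ F) as (C & C1 & HC & EC & Si & Ss).
  pose proof (branch_typed _ _ _ _ _ _ _ true _ F Hg) as Bg.
  pose proof (branch_typed _ _ _ _ _ _ _ false _ F Hh) as Bh.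
  eapply deq_transitive.
  - eapply deq_case with (s' := Op (inj d) [a]).
    + exact HC.
    + exact EC.
    + exact (Si true).
    + apply deq_reflexive; exact Bg.
    + exact (Si false).
    + apply deq_reflexive; exact Bh.
    + exact E.
    + exact (Ss _ Hs).
  (* The β-rule has its type at [inj a]; the motive is carried back to [s] along the assumed
     equality. *)
  - eapply deq_conv; [|eapply deq_symmetric, motive_equal; eauto].
    pose proof (Ss _ (inj_typed _ _ _ _ _ _ _ HA HB Ha)) as Sa.
    destruct d; [eapply deq_inl_beta with (Cl := motive (wk 1 P) (Op (inj true) [Var 0 []]))
        (Cr := motive (wk 1 P) (Op (inj false) [Var 0 []]))
      |eapply deq_inr_beta with (Cl := motive (wk 1 P) (Op (inj true) [Var 0 []]))
        (Cr := motive (wk 1 P) (Op (inj false) [Var 0 []]))];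
      [exact HC|exact EC|exact (Si true)|exact Bg|exact (Si false)|exact Bh|exact Ha|exact Sa|
       |exact HC|exact EC|exact (Si true)|exact Bg|exact (Si false)|exact Bh|exact Ha|exact Sa|];
      apply subst_op; constructor; auto; eapply subst_constant; eauto using typing_scoped.
Qed.

Lemma family_key Γ Δ i j k A B P : family Γ i j k A B P -> wf (Δ ++ ELock :: Γ) ->
  nlocks Δ = 0 ->
  family (EVar Tiny :: Δ ++ ELock :: Γ) i j k
    (kw (S (nvars Δ)) A) (kw (S (nvars Δ)) B) (kw (S (nvars Δ)) P).
Proof.
  intros F W L.
  pose proof (family_ren _ _ _ _ _ _ _ (S (nvars Δ)) true (EVar Tiny :: Δ ++ [ELock]) F) as R.
  cbn [app] in R; rewrite <- app_assoc in R. apply R; auto using insertion_key, wf_tiny.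
Qed.

Lemma partial_type_key n S d A B P : scoped S A -> scoped S B -> scoped S P ->
  kw (Datatypes.S n) (partial_type d A B P) =
  partial_type d (kw (Datatypes.S n) A) (kw (Datatypes.S n) B) (kw (Datatypes.S n) P).
Proof. apply (partial_type_ren (Datatypes.S n) true [] S _ d A B P (block_key n)). Qed.

Lemma partial_key Γ Δ i j k A B P d g : family Γ i j k A B P -> wf (Δ ++ ELock :: Γ) ->
  nlocks Δ = 0 -> Γ ⊢ g ∷ partial_type d A B P ->
  EVar Tiny :: Δ ++ ELock :: Γ ⊢ kw (S (nvars Δ)) g ∷
    partial_type d (kw (S (nvars Δ)) A) (kw (S (nvars Δ)) B) (kw (S (nvars Δ)) P).
Proof.
  intros (HA & HB & HP) W L Hg.
  rewrite <- (partial_type_key _ (shape Γ)) by eauto using typing_scoped.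
  exact (typing_kw _ _ _ _ W L Hg).
Qed.

(** * The recursor and its computation rule *)

Lemma wf_total Γ i j k A B P : family Γ i j k A B P ->
  ELock :: Γ ⊢ Pi Tiny (kw 1 (Sum A B)) ∷ Univ (Nat.max i j).
Proof.
  intros F. apply (wf_arrow Γ []); auto; [eapply family_sum; eauto|].
  destruct F as (HA & _). apply wf_lock; eauto using typing_wf.
Qed.

Lemma total_body_typed Γ i j k A B P g h : family Γ i j k A B P ->
  Γ ⊢ g ∷ partial_type true A B P -> Γ ⊢ h ∷ partial_type false A B P ->
  EVar (Pi Tiny (kw 1 (Sum A B))) :: ELock :: Γ ⊢
    Ev (Case (App (Var 1 []) (Var 0 [])) (branch (kw 2 g)) (branch (kw 2 h))) ∷
    App (dn 1 P) (Var 0 []).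
Proof.
  intros F Hg Hh. assert (W : wf (ELock :: Γ)) by (apply wf_lock; eauto using typing_wf).
  pose proof (family_sum _ _ _ _ _ _ _ F) as HS.
  pose proof (wf_total _ _ _ _ _ _ _ F) as HY.
  assert (W' : wf (EVar (Pi Tiny (kw 1 (Sum A B))) :: ELock :: Γ)) by (eapply wf_var; eauto).
  set (Δ := [EVar (Pi Tiny (kw 1 (Sum A B)))]).
  assert (Hf : Δ ++ ELock :: Γ ⊢ Var 0 [] ∷ Pi Tiny (kw 2 (Sum A B))).
  { pose proof (var_typed _ [] _ W' eq_refl) as R. cbn [nvars filter length app] in R.
    change (wk 1 (Pi Tiny (kw 1 (Sum A B)))) with (Pi Tiny (ren 1 false 1 0 (kw 1 (Sum A B)))) in R.
    rewrite (weak_kw _ _ (shape Γ)) in R by eauto using typing_scoped. exact R. }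
  eapply ty_conv; [|apply (predicate_app_equal Γ Δ i j k A B P
    (Lam (App (Var 1 []) (Var 0 []))) (Var 0 [])); auto;
    apply deq_symmetric; exact (eta _ _ _ _ Hf)].
  pose proof (apply_typed Γ Δ _ _ _ HS eq_refl Hf) as Hs.
  pose proof (case_typed _ _ _ _ _ _ _ _ _ _ (family_key _ Δ _ _ _ _ _ _ F W' eq_refl)
    (partial_key _ Δ _ _ _ _ _ _ _ _ F W' eq_refl Hg)
    (partial_key _ Δ _ _ _ _ _ _ _ _ F W' eq_refl Hh) Hs) as R.
  apply ty_ev in R. destruct F as (_ & _ & HP).
  (* Only [P] requires the triangle identity; for the variable [f], the unit of [(f i)⟨t/M⟩] is
     found by computation. *)
  cbn -[ren app] in R. rewrite (unit_lock_kw_kw 1 (shape Γ)) in R by eauto using typing_scoped.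
  exact R.
Qed.

Lemma total_typed Γ i j k A B P g h : family Γ i j k A B P ->
  Γ ⊢ g ∷ partial_type true A B P -> Γ ⊢ h ∷ partial_type false A B P ->
  Γ ⊢ Lock (total g h) ∷ total_type A B P.
Proof.
  intros F Hg Hh. eapply ty_lock, ty_lam; [eapply wf_total|eapply total_body_typed]; eauto.
Qed.

(** The variable [f], here of index 2 below [i] and the case variable, does not occur in the
    branches, since [g] comes from outside the lock. *)
Lemma subst_branch s g a : scoped s g -> subst a 2 (branch (kw 2 g)) (branch (kw 1 g)).
Proof.
  intros S. pose proof (scoped_ren 1 true [] [true; false] _ _ (block_key 0) S) as S1.
  cbn [nv nl app] in S1.
  pose proof (scoped_ren 1 false [] [true] _ _ (block_weak 1) S1) as S2.
  cbn [nv nl app] in S2.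
  (* Position [3 1] counts the binder of [ev], the case variable and [i], together with the lock
     [M]: the missing [f] sits just to the left of these. *)
  assert (E : kw 1 (wk 1 (kw 2 g)) = ren 1 false 3 1 (kw 1 (wk 1 (kw 1 g)))).
  { pose proof (ren_kw 1 false 0 _ [true; true] (false :: s) _ (block_weak 1) S2) as E1.
    pose proof (ren_wk 1 false 1 _ [true] (false :: s) _ (block_weak 1) S1) as E2.
    cbn [nv nl Nat.add] in E1, E2. rewrite E1, E2, (weak_kw _ _ s) by auto. reflexivity. }
  unfold branch. rewrite E.
  repeat first [apply Forall2_cons|apply Forall2_nil|apply subst_op|apply subst_abs|apply subst_labs].
  - apply (subst_weak a [true; false; true; true] (false :: s)).
    exact (scoped_ren 1 true [] [true; false] (true :: true :: false :: s) _ (block_key 0) S2).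
  - apply subst_inner; [lia|]. constructor; auto. apply subst_inner; auto; lia.
Qed.

Lemma subst_total_codomain s P c : scoped s P -> scoped (false :: s) c ->
  subst c 0 (App (dn 1 P) (Var 0 [])) (App (dn 0 P) c).
Proof.
  intros SP Sc. repeat first [apply (subst_kw 0 s); assumption
    |apply Forall2_cons|apply Forall2_nil|apply subst_op|apply subst_abs].
  eapply subst_this; [constructor|]. exact (counit_id [] _ _ Sc).
Qed.

Lemma inj_compose_beta Γ i j k A B P d l : family Γ i j k A B P ->
  ELock :: Γ ⊢ l ∷ Pi Tiny (kw 1 (pick d A B)) ->
  EVar Tiny :: ELock :: Γ ⊢
    App (wk 1 (Lam (Op (inj d) [App (wk 1 l) (Var 0 [])]))) (Var 0 []) ≡
    Op (inj d) [App (wk 1 l) (Var 0 [])] ∷ kw 1 (Sum A B).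
Proof.
  intros F Hl. pose proof (family_pick _ _ _ _ _ _ _ d F) as HX.
  pose proof F as (HA & HB & _).
  assert (W : wf (EVar Tiny :: ELock :: Γ)) by (apply wf_tiny; eauto using typing_wf).
  pose proof (typing_scoped _ _ _ Hl) as Sl.
  pose proof (typing_wk _ [EVar Tiny] _ _ W eq_refl Hl) as Hl1.
  cbn [nvars filter length app] in Hl1.
  change (wk 1 (Pi Tiny (kw 1 (pick d A B)))) with (Pi Tiny (ren 1 false 1 0 (kw 1 (pick d A B)))) in Hl1.
  rewrite (weak_kw _ _ (shape Γ)) in Hl1 by eauto using typing_scoped.
  pose proof (apply_typed Γ [EVar Tiny] _ _ _ HX eq_refl Hl1) as R.
  change (wk 1 (Lam (Op (inj d) [App (wk 1 l) (Var 0 [])]))) with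
    (Lam (Op (inj d) [App (ren 1 false 1 0 (wk 1 l)) (Var 0 [])])).
  rewrite (weak_wk _ _ _ _ Sl). rewrite (wk_wk _ _ _ _ Sl) in R.
  cbn [nvars filter length app Nat.add] in R |- *.
  eapply deq_pi_beta with (A := Tiny) (B := kw 2 (Sum A B)).
  - now apply ty_tiny.
  - cbn [ren map]. eapply inj_typed.
    + exact (typing_kw Γ [EVar Tiny] _ _ W eq_refl HA).
    + exact (typing_kw Γ [EVar Tiny] _ _ W eq_refl HB).
    + rewrite <- pick_ren. exact R.
  - exact (var_typed _ [] _ W eq_refl).
  - apply subst_op. constructor; auto. apply subst_op. constructor; [|constructor; auto].
    + exact (subst_wk 1 _ _ _ Sl).
    + eapply subst_this; [constructor|]. apply (counit_id [] []). repeat constructor.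
  - exact (subst_key 0 [] _ _ (typing_scoped _ _ _ (family_sum _ _ _ _ _ _ _ F))).
Qed.

(** The function part mentions [i] through its key and loses the outer passage by the triangle
    identity; in the argument, [l] does not mention [i], so that [(l i)⟨t/M⟩] becomes [l t]. *)
Lemma unit_lock_app s s' g l : scoped s g -> scoped s' l ->
  unit_lock 0 0 (App (dn 0 (kw 1 g)) (Lam (kw 1 (App (wk 1 l) (Var 0 []))))) =
  App (dn 0 g) (Lam (App (wk 1 l) (Var 0 []))).
Proof.
  intros Sg Sl.
  transitivity (App (Ev (unit_lock 1 0 (kw 1 (kw 1 g))))
    (Lam (App (unit_lock 1 0 (kw 1 (wk 1 l))) (Var 0 [])))); auto.
  now rewrite (unit_lock_kw_kw 0 s), (unit_lock_kw_wk s').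
Qed.

Lemma unit_lock_app_op o s s' g l : scoped s g -> scoped s' l ->
  unit_lock 0 0 (App (dn 0 (kw 1 g)) (Lam (kw 1 (Op o [App (wk 1 l) (Var 0 [])])))) =
  App (dn 0 g) (Lam (Op o [App (wk 1 l) (Var 0 [])])).
Proof.
  intros Sg Sl.
  transitivity (App (Ev (unit_lock 1 0 (kw 1 (kw 1 g))))
    (Lam (Op o [App (unit_lock 1 0 (kw 1 (wk 1 l))) (Var 0 [])]))); auto.
  now rewrite (unit_lock_kw_kw 0 s), (unit_lock_kw_wk s').
Qed.

Lemma pick_partial_typed Γ A B P g h d : Γ ⊢ g ∷ partial_type true A B P ->
  Γ ⊢ h ∷ partial_type false A B P -> Γ ⊢ pick d g h ∷ partial_type d A B P.
Proof. now destruct d. Qed.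

(** This holds for every [l] behind the lock, so that [l_↓] needs no special treatment. *)
Lemma total_beta Γ i j k A B P g h d l : family Γ i j k A B P ->
  Γ ⊢ g ∷ partial_type true A B P -> Γ ⊢ h ∷ partial_type false A B P ->
  ELock :: Γ ⊢ l ∷ Pi Tiny (kw 1 (pick d A B)) ->
  let c := Lam (Op (inj d) [App (wk 1 l) (Var 0 [])]) in
  ELock :: Γ ⊢ App (total g h) c ≡ App (dn 0 (pick d g h)) l ∷ App (dn 0 P) c.
Proof.
  intros F Hg Hh Hl c. pose proof F as (_ & _ & HP).
  pose proof (typing_wf _ _ _ Hl) as W.
  pose proof (inj_compose_typed Γ [] _ _ _ _ _ _ _ _ F eq_refl Hl) as Hc.
  pose proof (inj_compose_beta _ _ _ _ _ _ _ _ _ F Hl) as Hb.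
  fold c in Hc, Hb. cbn [nvars filter length app] in Hc.
  pose proof (family_pick _ _ _ _ _ _ _ d F) as HX.
  pose proof (family_sum _ _ _ _ _ _ _ F) as HS.
  pose proof (pick_partial_typed _ _ _ _ _ _ d Hg Hh) as Hgh.
  pose proof (typing_scoped _ _ _ HP) as SP; pose proof (typing_scoped _ _ _ Hg) as Sg.
  pose proof (typing_scoped _ _ _ Hh) as Sh; pose proof (typing_scoped _ _ _ Hc) as Sc.
  pose proof (family_key Γ [] _ _ _ _ _ _ F W eq_refl) as F1.
  pose proof (partial_key Γ [] _ _ _ _ _ _ _ _ F W eq_refl Hg) as Hg1.
  pose proof (partial_key Γ [] _ _ _ _ _ _ _ _ F W eq_refl Hh) as Hh1.
  pose proof (apply_typed Γ [] _ _ _ HS eq_refl Hc) as Hs.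
  pose proof (apply_typed Γ [] _ _ _ HX eq_refl Hl) as Ha.
  cbn [nvars filter length app] in F1, Hg1, Hh1, Hs, Ha. rewrite pick_ren in Ha.
  pose proof (pick_partial_typed _ _ _ _ _ _ d Hg1 Hh1) as Hgh1. rewrite <- pick_ren in Hgh1.
  eapply deq_transitive.
  { eapply deq_pi_beta with (B := App (dn 1 P) (Var 0 [])).
    - exact (wf_total _ _ _ _ _ _ _ F).
    - eapply total_body_typed; eauto.
    - exact Hc.
    - apply subst_op. constructor; auto. apply subst_abs, subst_op.
      constructor; [|constructor; [|constructor; [|constructor]]].
      + apply subst_op. constructor; [|constructor; [|constructor]].
        * eapply subst_this; [constructor|]. exact (weak_spec 1 _ _ Sc).
        * apply subst_inner; auto.
      + apply subst_abs. exact (subst_branch _ _ _ Sg).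
      + apply subst_abs. exact (subst_branch _ _ _ Sh).
    - eapply subst_total_codomain; eauto. }
  eapply deq_transitive.
  { eapply deq_conv.
    - eapply deq_ev. exact (case_beta _ _ _ _ _ _ _ _ _ _ d _ F1 Hg1 Hh1 Hs Ha Hb).
    (* The type coming out of [ev] is [P_↓(λ t. c t)]; η leads back to [P_↓(c)]. *)
    - rewrite (unit_lock_app _ _ _ _ SP Sc).
      apply (predicate_app_equal Γ [] i j k A B); auto.
      apply deq_symmetric; exact (eta _ _ _ _ Hc). }
  rewrite <- pick_ren.
  eapply deq_transitive.
  { pose proof (partial_constant_typed _ _ _ _ _ _ _ _ _ _ F1 Hgh1 Ha) as R.
    apply deq_sqrt_beta in R.
    rewrite (unit_lock_app _ _ _ _ (typing_scoped _ _ _ Hgh) (typing_scoped _ _ _ Hl)) in R.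
    rewrite (unit_lock_app_op _ _ _ _ _ SP (typing_scoped _ _ _ Hl)) in R. exact R. }
  apply deq_symmetric.
  (* What remains is [λ t. l t] against [l]. *)
  eapply partial_app_equal; eauto. exact (eta _ _ _ _ Hl).
Qed.

Lemma total_type_typed Γ i j k A B P : family Γ i j k A B P ->
  Γ ⊢ total_type A B P ∷ Univ (Nat.max (Nat.max i j) k).
Proof.
  intros F. pose proof (wf_total _ _ _ _ _ _ _ F) as HY.
  assert (W : wf (EVar (Pi Tiny (kw 1 (Sum A B))) :: ELock :: Γ))
    by (eapply wf_var; eauto using typing_wf).
  apply ty_sqrt, ty_pi; [exact HY|].
  apply (predicate_app_typed Γ [EVar _] i j k A B); auto.
  pose proof (var_typed _ [] _ W eq_refl) as R. cbn [nvars filter length app] in R |- *.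
  change (wk 1 (Pi Tiny (kw 1 (Sum A B)))) with (Pi Tiny (ren 1 false 1 0 (kw 1 (Sum A B)))) in R.
  rewrite (weak_kw _ _ (shape Γ)) in R by eauto using typing_scoped, family_sum. exact R.
Qed.

(** * The recursor as a function on pairs *)

Definition eliminator : tm := Lam (Lock (total (Fst (Var 0 [])) (Snd (Var 0 [])))).

Definition pair_type (A B P : tm) : tm :=
  Sig (partial_type true A B P) (wk 1 (partial_type false A B P)).

Lemma weak_typed Γ A X i j : Γ ⊢ A ∷ Univ i -> Γ ⊢ X ∷ Univ j -> EVar X :: Γ ⊢ wk 1 A ∷ Univ i.
Proof.
  intros HA HX. assert (W : wf (EVar X :: Γ)) by (eapply wf_var; eauto using typing_wf).
  exact (typing_wk _ [_] _ _ W eq_refl HA).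
Qed.

Lemma pair_type_typed Γ i j k A B P : family Γ i j k A B P ->
  exists u, Γ ⊢ pair_type A B P ∷ Univ u.
Proof.
  intros F. eexists. eapply ty_sig; [|eapply weak_typed]; eapply partial_type_typed; eauto.
Qed.

Lemma eliminator_body_typed Γ i j k A B P : family Γ i j k A B P ->
  EVar (pair_type A B P) :: Γ ⊢ Lock (total (Fst (Var 0 [])) (Snd (Var 0 []))) ∷
    wk 1 (total_type A B P).
Proof.
  intros F. destruct (pair_type_typed _ _ _ _ _ _ _ F) as [u HS].
  pose proof (family_weak _ _ _ _ _ _ _ _ _ F HS) as F1. pose proof F as (HA & HB & HP).
  pose proof (typing_scoped _ _ _ HA) as SA; pose proof (typing_scoped _ _ _ HB) as SB.
  pose proof (typing_scoped _ _ _ HP) as SP.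
  assert (W : wf (EVar (pair_type A B P) :: Γ)) by (eapply wf_var; eauto using typing_wf).
  pose proof (var_typed _ [] _ W eq_refl) as Hv. cbn [nvars filter length app] in Hv.
  change (wk 1 (pair_type A B P)) with (Sig (wk 1 (partial_type true A B P))
    (ren 1 false 1 0 (wk 1 (partial_type false A B P)))) in Hv.
  pose proof (typing_scoped _ _ _ (partial_type_typed _ _ _ _ _ _ _ false F)) as SH.
  rewrite (weak_wk _ _ _ _ SH) in Hv.
  pose proof (total_type_ren 1 false [] (shape Γ) _ A B P (block_weak 1) SA SB SP) as E.
  cbn [nv nl] in E. rewrite E. eapply total_typed; eauto.
  - rewrite <- (partial_type_weak _ _ _ _ _ _ SA SB SP). eapply ty_fst; eauto.
  - rewrite <- (partial_type_weak _ _ _ _ _ _ SA SB SP). eapply ty_snd; eauto.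
    exact (subst_wk 1 _ _ _ SH).
Qed.

Lemma counit_var p ks x s : Forall (scoped s) ks -> counit p ks 0 0 (Var x []) (Var (p + x) ks).
Proof.
  intros F. pose proof (counit_outer p ks 0 0 x [] [] [] [] ks) as H.
  cbn [app] in H. rewrite app_nil_r in H.
  apply H; auto; [lia|]. eapply Forall2_counit_id; eauto.
Qed.

Lemma subst_eliminator x y : let p := Pair (Var x []) (Var y []) in
  subst p 0 (Lock (total (Fst (Var 0 [])) (Snd (Var 0 [])))) (Lock (total (Fst p) (Snd p))).
Proof.
  cbn.
  repeat first [apply Forall2_cons|apply Forall2_nil|apply subst_op|apply subst_abs
    |apply subst_labs|apply subst_inner; [lia|]|eapply subst_this].
  all: repeat constructor.
  (* The pair crosses [f], [i], the case variable and the binder of the inner [ev]. Its keys, for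
     [L] and [M], are formed over the last three of these and [M], whence the list. *)
  all: apply (counit_var 4 _ _ [true; false; true; true]).
  all: repeat constructor.
Qed.

Lemma pair_typed Γ i j k A B P g h : family Γ i j k A B P ->
  Γ ⊢ g ∷ partial_type true A B P -> Γ ⊢ h ∷ partial_type false A B P ->
  Γ ⊢ Pair g h ∷ pair_type A B P.
Proof.
  intros F Hg Hh. pose proof (partial_type_typed _ _ _ _ _ _ _ false F) as HH.
  eapply ty_pair; [|exact Hg| |exact Hh].
  - eapply weak_typed; eauto using partial_type_typed.
  - exact (subst_weak _ [] _ _ (typing_scoped _ _ _ HH)).
Qed.

(** The arguments are variables, so that substituting the pair into [eliminator] is a finite
    computation with explicit keys. The projections of the pair survive [total_beta] and are reduced
    afterwards, under [↓]. *)
Lemma eliminator_computes Γ i j k A B P d x y l : family Γ i j k A B P ->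
  Γ ⊢ Var x [] ∷ partial_type true A B P -> Γ ⊢ Var y [] ∷ partial_type false A B P ->
  Γ ⊢ l ∷ Sqrt (Pi Tiny (kw 1 (pick d A B))) ->
  let c := Lam (Op (inj d) [App (wk 1 (dn 0 l)) (Var 0 [])]) in
  ELock :: Γ ⊢ App (dn 0 (App eliminator (Pair (Var x []) (Var y [])))) c ≡
    App (dn 0 (pick d (Var x []) (Var y []))) (dn 0 l) ∷ App (dn 0 P) c.
Proof.
  intros F Hx Hy Hl c. pose proof F as (_ & _ & HP).
  set (p := Pair (Var x []) (Var y [])).
  assert (W : wf (ELock :: Γ)) by (apply wf_lock; eauto using typing_wf).
  pose proof (typing_scoped _ _ _ HP) as SP.
  pose proof (pair_typed _ _ _ _ _ _ _ _ _ F Hx Hy) as Hp. fold p in Hp.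
  pose proof (partial_type_typed _ _ _ _ _ _ _ false F) as HH.
  destruct (pair_type_typed _ _ _ _ _ _ _ F) as [u HS].
  assert (Hg : Γ ⊢ Fst p ∷ partial_type true A B P) by (eapply ty_fst; exact Hp).
  assert (Hh : Γ ⊢ Snd p ∷ partial_type false A B P).
  { eapply ty_snd; [exact Hp|]. exact (subst_weak _ [] _ _ (typing_scoped _ _ _ HH)). }
  pose proof (down_typed Γ [] _ _ W eq_refl Hl) as Hd. cbn [nvars filter length app] in Hd.
  pose proof (type_scoped _ _ _ Hl) as Sl. inversion Sl as [|? ? ? Fl| |]; subst.
  inversion Fl as [|? ? Sl' _]; inversion Sl'; subst.
  rewrite (ren_0 (false :: shape Γ)) in Hd by auto.
  pose proof (inj_compose_typed Γ [] _ _ _ _ _ _ _ _ F eq_refl Hd) as Hc. fold c in Hc.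
  pose proof (typing_scoped _ _ _ Hc) as Sc.
  pose proof (total_typed _ _ _ _ _ _ _ _ _ F Hg Hh) as HT.
  eapply deq_transitive.
  { eapply deq_app; [|apply deq_reflexive; exact Hc|eapply subst_total_codomain; eauto].
    assert (E : Γ ⊢ App eliminator p ≡ Lock (total (Fst p) (Snd p)) ∷ total_type A B P).
    { eapply deq_pi_beta; [exact HS|eapply eliminator_body_typed; exact F|exact Hp| |].
      - apply subst_eliminator.
      - exact (subst_weak _ [] _ _ (typing_scoped _ _ _ (total_type_typed _ _ _ _ _ _ _ F))). }
    apply (down_equal Γ []) in E; auto. cbn [nvars filter length app] in E.
    rewrite (ren_0 (false :: shape Γ)) in E.
    - eapply deq_transitive; [exact E|]. apply down_lock.
      eapply ty_lam; [eapply wf_total|eapply total_body_typed]; eauto.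
    - exact (type_scoped _ _ _ (ty_lam _ _ _ _ _ (wf_total _ _ _ _ _ _ _ F)
        (total_body_typed _ _ _ _ _ _ _ _ _ F Hg Hh))). }
  eapply deq_transitive; [eapply total_beta; eauto|].
  assert (E : Γ ⊢ pick d (Fst p) (Snd p) ≡ pick d (Var x []) (Var y []) ∷ partial_type d A B P).
  { pose proof (weak_typed _ _ _ _ _ HH (partial_type_typed _ _ _ _ _ _ _ true F)) as HH1.
    pose proof (subst_weak (Var x []) [] _ _ (typing_scoped _ _ _ HH)) as SH.
    destruct d; [eapply deq_fst_beta|eapply deq_snd_beta]; eauto. }
  apply (down_equal Γ []) in E; auto. cbn [nvars filter length app] in E.
  pose proof (type_scoped _ _ _ (pick_partial_typed _ _ _ _ _ _ d Hg Hh)) as Sg.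
  inversion Sg as [|? ? ? Fg| |]; subst. inversion Fg as [|? ? Sg' _]; inversion Sg'; subst.
  rewrite (ren_0 (false :: shape Γ)) in E by auto.
  eapply deq_app; [exact E|apply deq_reflexive; exact Hd|].
  eapply subst_partial_codomain; eauto using typing_scoped. exact (typing_scoped _ _ _ Hd).
Qed.

Theorem proposition4p1 (Γ : ctx) (i j k : nat) (A B : tm)
    (hA : Γ ⊢ A ∷ Univ i) (hB : Γ ⊢ B ∷ Univ j) :
  exists At Bt : tm, keyed 1 A At /\ keyed 1 B Bt /\
  forall P : tm, Γ ⊢ P ∷ Sqrt (Pi (Pi Tiny (Sum At Bt)) (Univ k)) ->
  exists P1 : tm, down 1 P P1 /\
  let G := Sqrt (Pi (Pi Tiny At)
             (App P1 (Lam (Inl (App (Var 1 []) (Var 0 [])))))) in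
  let H := Sqrt (Pi (Pi Tiny Bt)
             (App P1 (Lam (Inr (App (Var 1 []) (Var 0 [])))))) in
  let K := Sqrt (Pi (Pi Tiny (Sum At Bt)) (App P1 (Var 0 []))) in
  exists H1 K1 : tm, weak 1 H H1 /\ weak 1 K K1 /\
  exists hind : tm,
    Γ ⊢ hind ∷ Pi (Sig G H1) K1 /\
    (* Γ, g : G, h : H, l : √(∏ A⟨t⟩), r : √(∏ B⟨t⟩), lock *)
    exists L R : tm,
      weak 2 (Sqrt (Pi Tiny At)) L /\ weak 3 (Sqrt (Pi Tiny Bt)) R /\
    let Δ := EVar R :: EVar L :: EVar H1 :: EVar G :: Γ in
    exists hind' hd Pd : tm,
      weak 4 hind hind' /\
      down 0 (App hind' (Pair (Var 3 []) (Var 2 []))) hd /\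
      down 4 P Pd /\
      ELock :: Δ ⊢ App hd (Lam (Inl (App (vdown 2) (Var 0 []))))
                 ≡ App (vdown 3) (vdown 1)
                 ∷ App Pd (Lam (Inl (App (vdown 2) (Var 0 [])))) /\
      ELock :: Δ ⊢ App hd (Lam (Inr (App (vdown 1) (Var 0 []))))
                 ≡ App (vdown 2) (vdown 0)
                 ∷ App Pd (Lam (Inr (App (vdown 1) (Var 0 [])))).
Proof.
  pose proof (typing_scoped _ _ _ hA) as SA; pose proof (typing_scoped _ _ _ hB) as SB.
  exists (kw 1 A), (kw 1 B). split; [exact (keyed_spec 0 _ _ SA)|].
  split; [exact (keyed_spec 0 _ _ SB)|]. intros P HP.
  assert (F : family Γ i j k A B P) by (split; auto).
  pose proof (typing_scoped _ _ _ HP) as SP.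
  exists (dn 1 P). split; [exists (kw 2 P); split; auto; exact (keyed_spec 1 _ _ SP)|].
  intros G H K.
  pose proof (partial_type_typed _ _ _ _ _ _ _ true F) as HG.
  pose proof (partial_type_typed _ _ _ _ _ _ _ false F) as HH.
  pose proof (total_type_typed _ _ _ _ _ _ _ F) as HK.
  change (Γ ⊢ G ∷ Univ (Nat.max i k)) in HG. change (Γ ⊢ H ∷ Univ (Nat.max j k)) in HH.
  change (partial_type true A B P) with G in *.
  pose proof (typing_scoped _ _ _ HH) as SH; pose proof (typing_scoped _ _ _ HK) as SK.
  exists (wk 1 H), (wk 1 K). split; [exact (weak_spec 1 _ _ SH)|].
  split; [exact (weak_spec 1 _ _ SK)|].
  exists eliminator.
  assert (He : Γ ⊢ eliminator ∷ Pi (Sig G (wk 1 H)) (wk 1 K)).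
  { destruct (pair_type_typed _ _ _ _ _ _ _ F) as [u HS].
    eapply ty_lam; [exact HS|eapply eliminator_body_typed; exact F]. }
  split; [exact He|].
  assert (HL : forall d, Γ ⊢ Sqrt (Pi Tiny (kw 1 (pick d A B))) ∷ Univ (pick d i j)).
  { intros d. apply ty_sqrt. apply (wf_arrow Γ []); auto; [eapply family_pick; eauto|].
    apply wf_lock; eauto using typing_wf. }
  set (L := wk 2 (Sqrt (Pi Tiny (kw 1 A)))). set (R := wk 3 (Sqrt (Pi Tiny (kw 1 B)))).
  exists L, R.
  split; [exact (weak_spec 2 _ _ (typing_scoped _ _ _ (HL true)))|].
  split; [exact (weak_spec 3 _ _ (typing_scoped _ _ _ (HL false)))|].
  intros Δ.
  assert (W1 : wf (EVar G :: Γ)) by (eapply wf_var; eauto using typing_wf).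
  assert (W2 : wf (EVar (wk 1 H) :: EVar G :: Γ))
    by (eapply wf_var; eauto; eapply weak_typed; eauto).
  assert (W3 : wf (EVar L :: EVar (wk 1 H) :: EVar G :: Γ)).
  { eapply wf_var; auto. exact (typing_wk Γ [_; _] _ _ W2 eq_refl (HL true)). }
  assert (W : wf Δ).
  { eapply wf_var; auto. exact (typing_wk Γ [_; _; _] _ _ W3 eq_refl (HL false)). }
  (* The equations live over [Δ]. The data are transported there by a weakening past four variables,
     and the computation is carried out afresh over [Δ]. *)
  pose proof (family_ren _ _ _ _ _ _ _ 4 false
    [EVar R; EVar L; EVar (wk 1 H); EVar G] F W
    (insertion_weak [EVar R; EVar L; EVar (wk 1 H); EVar G] eq_refl)) as FD.
  change ([EVar R; EVar L; EVar (wk 1 H); EVar G] ++ Γ) with Δ in FD.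
  assert (Hx : Δ ⊢ Var 3 [] ∷ partial_type true (wk 4 A) (wk 4 B) (wk 4 P)).
  { rewrite <- (partial_type_weak 4 _ true _ _ _ SA SB SP).
    exact (var_typed Γ [_; _; _] G W eq_refl). }
  assert (Hy : Δ ⊢ Var 2 [] ∷ partial_type false (wk 4 A) (wk 4 B) (wk 4 P)).
  { rewrite <- (partial_type_weak 4 _ false _ _ _ SA SB SP).
    pose proof (var_typed (EVar G :: Γ) [_; _] _ W eq_refl) as V.
    cbn [nvars filter length app] in V. rewrite (wk_wk _ _ _ _ SH) in V. exact V. }
  assert (EL : forall d, wk 4 (Sqrt (Pi Tiny (kw 1 (pick d A B)))) =
    Sqrt (Pi Tiny (kw 1 (pick d (wk 4 A) (wk 4 B))))).
  { intros d. rewrite <- pick_ren.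
    pose proof (ren_kw 4 false 0 _ [] _ (pick d A B) (block_weak 4)
      (typing_scoped _ _ _ (family_pick _ _ _ _ _ _ _ d F))) as E.
    cbn [nv nl Nat.add] in E. now rewrite <- E. }
  assert (Hl : Δ ⊢ Var 1 [] ∷ Sqrt (Pi Tiny (kw 1 (pick true (wk 4 A) (wk 4 B))))).
  { rewrite <- EL. pose proof (var_typed _ [_] _ W eq_refl) as V. unfold L in V.
    cbn [nvars filter length app] in V.
    rewrite (wk_wk _ _ _ _ (typing_scoped _ _ _ (HL true))) in V. exact V. }
  assert (Hr : Δ ⊢ Var 0 [] ∷ Sqrt (Pi Tiny (kw 1 (pick false (wk 4 A) (wk 4 B))))).
  { rewrite <- EL. pose proof (var_typed _ [] _ W eq_refl) as V. unfold R in V.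
    cbn [nvars filter length app] in V.
    rewrite (wk_wk _ _ _ _ (typing_scoped _ _ _ (HL false))) in V. exact V. }
  (* As a closed term, [eliminator] is its own weakening. *)
  exists eliminator, (dn 0 (App eliminator (Pair (Var 3 []) (Var 2 [])))), (dn 0 (wk 4 P)).
  split; [exact (weak_spec 4 _ _ (typing_scoped _ _ _ He))|].
  split.
  { eexists; split; [|reflexivity]. apply (keyed_spec 0 (shape Δ)).
    constructor. constructor; [|constructor; [|constructor]].
    - exact (scoped_ren 4 false [] [true; true; true; true] _ _ (block_weak 4)
        (typing_scoped _ _ _ He)).
    - exact (typing_scoped _ _ _ (pair_typed _ _ _ _ _ _ _ _ _ FD Hx Hy)). }
  split.
  (* The four variables of [Δ] beyond [Γ] and the binder of [ev] give 5; weakening first and then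
     crossing the lock is the same as crossing everything at once. *)
  { exists (kw 5 P); split; [exact (keyed_spec 4 _ _ SP)|].
    rewrite (kw_wk _ _ _ _ SP). reflexivity. }
  split.
  (* By computation, [dn 0 (Var 1 [])] is [vdown 1], and its weakening under [λ t] is [vdown 2]. *)
  - exact (eliminator_computes _ _ _ _ _ _ _ true _ _ _ FD Hx Hy Hl).
  - exact (eliminator_computes _ _ _ _ _ _ _ false _ _ _ FD Hx Hy Hr).
Qed.
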